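(* Let $t_K^\star=\frac{K^2\log K}{\pi^2}$ and let $\theta_K^{\mathrm{SWT}}(\varepsilon)$ be the $\varepsilon$-transience time of the SSEP with traps on the ring with $K$ sites. There exists $C>0$ such that for all integers $K\ge 2$ and all $0<\varepsilon<1$, $$\left|\theta_K^{\mathrm{SWT}}(\varepsilon)-t_K^\star\right|\le CK^2\left(1+\log\frac{\log K}{\varepsilon\wedge(1-\varepsilon)}\right).$$ In particular, the transience time exhibits cutoff: for all $0<\varepsilon<1$, $$\lim_{K\to\infty}\frac{\theta_K^{\mathrm{SWT}}(\varepsilon)}{\theta_K^{\mathrm{SWT}}(\frac14)}=1 .$$
   Context: For an integer $K\ge 1$ let $\mathbb{T}_K=\{1,\dots,K\}$ be the periodic ring (indices mod $K$) and $\Gamma_K=\{n\in\mathbb{Z}: n\le 1\}^{\mathbb{T}_K}$. For $\xi\in\Gamma_K$: $\xi_k=1$ means site $k$ holds a (live) particle, $\xi_k=0$ means it is empty, $\xi_k<0$ means it holds a trap of depth $|\xi_k|$. The SSEP with traps (SWT) on $\mathbb{T}_K$ is the continuous-time Markov process on $\Gamma_K$ with generator $$\mathscr{L}f(\xi)=\sum_{k\in\mathbb{T}_K}\sum_{z=\pm1}\mathbf{1}_{\{\xi_k=1,\ \xi_{k+z}\le 0\}}\{f(\xi^{k,k+z})-f(\xi)\},$$ where $\xi^{k,k+z}$ equals $0$ at $k$, $\xi_{k+z}+1$ at $k+z$, and $\xi_{k'}$ at every other site $k'$. Let $\mathbf{P}^K_\xi$ be its law started from $\xi$. Set $|\xi^-|=-\sum_k\min(\xi_k,0)$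 and $|\xi^+|=\sum_k\mathbf{1}_{\{\xi_k=1\}}$. The set of transient configurations is $\mathcal{T}_K^{\mathrm{SWT}}=\{\xi\in\Gamma_K: |\xi^-|>0,\ |\xi^+|>0\}$. For $\xi\in\Gamma_K$ let $p_\xi(t)=\mathbf{P}^K_\xi(\xi(t)\in\mathcal{T}_K^{\mathrm{SWT}})$, let $p_K^{\mathrm{SWT}}(t)=\sup\{p_\xi(t):\xi\in\Gamma_K\}$, and $\theta_K^{\mathrm{SWT}}(\varepsilon)=\inf\{t\ge0: p_K^{\mathrm{SWT}}(t)\le\varepsilon\}$. *)

(* Defs.v *)
From mathcomp Require Import all_boot all_order all_algebra.
From mathcomp Require Import all_classical all_reals all_analysis.

Set Implicit Arguments.
Unset Strict Implicit.
Unset Printing Implicit Defensive.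

Import Order.TTheory GRing.Theory Num.Theory.
Import numFieldNormedType.Exports.

Local Open Scope classical_set_scope.
Local Open Scope ring_scope.

(* A Markov family (P_x) of cadlag processes on a countable (discrete) state
   space with generator L: mp_law x is P_x and mp_path t is X_t.  The last field
   says that the right derivative at t = 0 of E_x[f(X_t)] is (L f)(x) for all
   bounded f. *)
Record markov_process (R : realType) (S : countType)
    (L : (S -> R) -> S -> R) := MarkovProcess {
  mp_disp : measure_display;
  mp_space : measurableType mp_disp;
  mp_law : S -> probability mp_space R;
  mp_path : R -> mp_space -> S;
  mp_measurable : forall (t : R) (B : set S), 0 <= t ->
    measurable (mp_path t @^-1` B);
  mp_right_continuous : forall w (t : R), 0 <= t ->
    \forall s \near t^'+, mp_path s w = mp_path t w;
  mp_left_limit : forall w (t : R), 0 < t ->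
    exists x, \forall s \near t^'-, mp_path s w = x;
  mp_start : forall x, mp_law x (mp_path 0 @^-1` [set x]) = 1%E;
  mp_markov : forall x (s t : R) (A : set mp_space) y (B : set S),
    0 <= s -> 0 <= t ->
    <<s [set mp_path u @^-1` D | u in [set u | 0 <= u <= s] & D in setT] >> A ->
    mp_law x (A `&` mp_path s @^-1` [set y] `&` mp_path (s + t) @^-1` B) =
    (mp_law x (A `&` mp_path s @^-1` [set y])
      * mp_law y (mp_path t @^-1` B))%E;
  mp_generator : forall (f : S -> R) x,
    (exists M : R, forall y, `|f y| <= M) ->
    (fine 'E_(mp_law x)[f \o mp_path t] - f x) / t @[t --> 0^'+] --> L f x
}.

Arguments mp_law {R S L} _ _.
Arguments mp_path {R S L} _ _ _.

Section SWT.
Variables (R : realType) (K : nat).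

(* The sites are 'I_K (0, ..., K-1 instead of 1, ..., K); the neighbours k + 1
   and k - 1 modulo K are ordS k and ord_pred k. *)
Definition config : Type :=
  {xi : {ffun 'I_K -> int} | [forall k, xi k <= 1]}.

Implicit Type xi : config.

Definition jump_fun xi (k l : 'I_K) : {ffun 'I_K -> int} :=
  [ffun j => if j == k then 0 else if j == l then val xi l + 1 else val xi j].

(* The default value xi is never used when the jump is allowed: see
   val_jump. *)
Definition jump xi (k l : 'I_K) : config := insubd xi (jump_fun xi k l).

Lemma val_jump xi k l : val xi l <= 0 -> val (jump xi k l) = jump_fun xi k l.
Proof.
move=> xil; rewrite insubdK//; apply/forallP => j; rewrite ffunE.
case: ifP => // _; case: ifP => [_|_]; first by rewrite gerDr.
exact: (forallP (valP xi)).
Qed.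

(* For K = 2 the two neighbours coincide and the jump is counted twice, as in
   the sum over z = 1, -1. *)
Definition swt_generator (f : config -> R) xi : R :=
  \sum_(k < K) \sum_(l <- [:: ordS k; ord_pred k])
    ((val xi k == 1) && (val xi l <= 0))%:R * (f (jump xi k l) - f xi).

Definition trap_depth xi : int := - \sum_(k < K) Num.min (val xi k) 0.

Definition live_particles xi : nat := (\sum_(k < K) (val xi k == 1))%N.

Definition transient : set config :=
  [set xi | 0 < trap_depth xi /\ (0 < live_particles xi)%N].

Definition swt := markov_process swt_generator.

Definition transient_prob_from (X : swt) xi (t : R) : \bar R :=
  mp_law X xi (mp_path X t @^-1` transient).

Definition transient_prob (X : swt) (t : R) : \bar R :=
  ereal_sup [set transient_prob_from X xi t | xi in setT].

(* In \bar R, so that the infimum of the empty set is +oo. *)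
Definition transience_time (X : swt) (eps : R) : \bar R :=
  ereal_inf [set t%:E | t in
    [set t : R | 0 <= t /\ (transient_prob X t <= eps%:E)%E]].

Definition tstar : R := K%:R ^+ 2 * ln K%:R / pi ^+ 2.

End SWT.

(* Main.v *)
Require Import Defs.
From mathcomp Require Import all_boot all_order all_algebra.
From mathcomp Require Import all_classical all_reals all_analysis.
From mathcomp Require Import zify ring lra.
Import Order.TTheory GRing.Theory Num.Theory.
Import numFieldNormedType.Exports.
Local Open Scope classical_set_scope.
Local Open Scope ring_scope.

(** Write u(t, xi) for the probability that the process started from xi is
    transient at time t.  The Markov property and the generator give the backward
    equation: t |-> u(t, xi) is continuous and has right derivative
    (L u(t, .))(xi) ([occupation_right_derivative]).  On a finite set of
    configurations stable under the dynamics, u is therefore dominated by every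
    function v with v(0, .) >= u(0, .) and dv/dt >= L v
    ([comparison_principle], [occupation_comparison]), and everything reduces to
    finding explicit supersolutions v.

    They are products.  The generator is a sum over the bonds of the ring of
    terms f(stir k xi) - f(xi).  If a(t, k) solves the discrete heat equation off
    a trap x, then prod_k (1 + a(t, k) 1_{xi_k = 1}) is a supersolution: on a bond
    with two live particles the error is a square, with the right sign, and at a
    trap the sign of a decides ([prodf_stir_le]).  This replaces the negative
    dependence of the exclusion process.  The profiles used are
    exp(- mu t) cos (theta (d - K/2)), d being the distance travelled from x around
    the ring and mu = 2 (1 - cos theta).

    Lower bound on the transience time.  One trap of depth K and particles
    everywhere else: take theta = pi / K, for which the profile vanishes at x, and
    a = - exp(- mu t) sin (pi d / K).  The probability that no particle is left is at
    most exp (- exp(- mu t) S) with S = sum_d sin (pi d / K) >= K / 6 and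
    mu <= pi^2 / K^2, so this probability can reach 1 - eps
    only if mu t >= log K - O(1 + log (1 / (1 - eps))).

    Upper bound.  The process is monotone in xi and the sum of the xi_k is
    conserved, so configurations with negative sum are dominated by configurations
    with zero sum ([occupation_transient_le], [fill_to_zero]).  When the sum is
    nonnegative, the number of traps is at most the number N of particles
    ([traps_le]).  Summing over the traps x the supersolution
    1_{xi_x < 0} (prod_k (1 + a(t, k) 1_{xi_k = 1}) - 1) with a > 0 controls
    exponential moments of N on the event that some trap survives.  A first
    period, of length about log K / mu, brings N down to M = O(log (K / eps));
    from such a configuration the union over at most M traps costs a factor M only
    ([two_stage]).  The profile has to be bounded below, so theta is taken slightly
    less than pi / K: theta = (pi / K) log K / (1 + log K) changes log K / mu by
    O(K^2) and keeps the profile above 1 / (3 (1 + log K)).  The losses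
    are powers of log K and of 1 / eps, hence the window
    K^2 (1 + log (log K / min (eps, 1 - eps))). *)

Set Implicit Arguments.
Unset Strict Implicit.
Unset Printing Implicit Defensive.

(** * The backward equation of a Markov process *)

Section MarkovSemigroup.
Context {R : realType} {S : countType} {L : (S -> R) -> S -> R}.
Variable X : markov_process L.

Local Notation E x f t := (fine 'E_(mp_law X x)[f \o mp_path X t]).

Definition occupation (B : set S) (t : R) (x : S) : R :=
  fine (mp_law X x (mp_path X t @^-1` B)).

Lemma prob_fin_num d (T : measurableType d) (P : probability T R) A :
  measurable A -> P A \is a fin_num.
Proof. by move=> mA; exact: fin_num_measure. Qed.

Lemma path_measurable (f : S -> R) t : 0 <= t ->
  measurable_fun setT (f \o mp_path X t).
Proof.
move=> t0 _ Y mY; rewrite setTI comp_preimage.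
exact: mp_measurable.
Qed.

Lemma path_bounded_integrable (f : S -> R) x t (M : R) : 0 <= t ->
  (forall y, `|f y| <= M) ->
  (mp_law X x).-integrable setT (EFin \o (f \o mp_path X t)).
Proof.
move=> t0 fM; apply: (@measurable_bounded_integrable _ _ _ (mp_law X x)).
- exact: measurableT.
- exact: fin_num_fun_lty.
- exact: path_measurable.
- exists M; split; first exact: num_real.
  by move=> N MN w _ /=; apply: (le_trans (fM _)); exact: ltW.
Qed.

(** The integral is computed on the countable partition according to the
    position at time s, on each cell of which the integrand is constant. *)
Lemma occupation_markov (B : set S) x (s t : R) : 0 <= s -> 0 <= t ->
  occupation B (s + t) x = E x (occupation B t) s.
Proof.
move=> s0 t0; congr fine; rewrite unlock.
pose F n := mp_path X s @^-1` [set y : S | pickle y = n].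
have mF n : measurable (F n) by exact: mp_measurable.
have FT : \bigcup_n F n = setT.
  by rewrite -subTset => w _; exists (pickle (mp_path X s w)).
have tF : trivIset setT F by move=> i j _ _ [w [<- <-]].
rewrite -FT ge0_integral_bigcup//; last 2 first.
- rewrite FT; apply/measurable_realfun.measurable_EFinP; exact: path_measurable.
- by move=> w _; rewrite lee_fin fine_ge0.
have mB := mp_measurable X B (addr_ge0 s0 t0).
rewrite -[X in mp_law _ _ X]setTI -FT setI_bigcupl measure_bigcup//=; last 2 first.
- by move=> i _; exact: measurableI.
- by apply: trivIset_setIr.
have inT : (fun i : nat => i \in [set: nat]) =1 xpredT by move=> i; exact: mem_set.
rewrite (eq_eseriesl _ _ inT).
apply: eq_eseriesr => n _.
have [[y yn]|ny] := pselect (exists y : S, pickle y = n); last first.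
  have -> : F n = set0 by rewrite -subset0 => w Fw; apply: ny; exists (mp_path X s w).
  by rewrite set0I measure0 integral_set0.
have FE : F n = mp_path X s @^-1` [set y].
  by apply/seteqP; split=> w; rewrite /F /= -yn; [move/(pcan_inj pickleK)|move->].
rewrite (eq_integral (fun=> (occupation B t y)%:E)); last first.
  by move=> w /set_mem; rewrite FE /= => ->.
rewrite integral_cst// fineK; last exact/prob_fin_num/mp_measurable.
have := mp_markov (m := X) x (A := setT) y B s0 t0 (@measurableT _ (g_sigma_algebraType _)).
by rewrite !setTI -FE muleC.
Qed.

Lemma occupation_ge0 (B : set S) t x : 0 <= occupation B t x.
Proof. exact: fine_ge0. Qed.

Lemma occupation_le1 (B : set S) t x : 0 <= t -> occupation B t x <= 1.
Proof.
move=> t0; rewrite -lee_fin fineK; last exact/prob_fin_num/mp_measurable.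
exact/probability_le1/mp_measurable.
Qed.

Lemma occupation0 (B : set S) x : occupation B 0 x = (x \in B)%:R.
Proof.
have mB := mp_measurable X B (lexx 0).
have mx := mp_measurable X [set x] (lexx 0).
have p1 := mp_start X x.
rewrite /occupation; case: (boolP (x \in B)) => [/set_mem xB|/negP xB].
  suff -> : mp_law X x (mp_path X 0 @^-1` B) = 1%E by [].
  apply/eqP; rewrite eq_le probability_le1//= -p1 le_measure ?inE//.
  by move=> w /= ->.
suff -> : mp_law X x (mp_path X 0 @^-1` B) = 0%E by [].
apply/eqP; rewrite eq_le measure_ge0 andbT.
have <- : mp_law X x (~` (mp_path X 0 @^-1` [set x])) = 0%E.
  by rewrite probability_setC// p1 subee.
rewrite le_measure ?inE//; first exact: measurableC.
by move=> w /= wB wx; apply: xB; rewrite inE -wx.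
Qed.

(** By the Markov property this is the generator identity applied to the bounded
    function occupation B t, so no exchange of limit and expectation occurs. *)
Lemma occupation_right_derivative (B : set S) x (t : R) : 0 <= t ->
  (occupation B (t + h) x - occupation B t x) / h @[h --> 0^'+] -->
    L (occupation B t) x.
Proof.
move=> t0.
have bf : exists M : R, forall y, `|occupation B t y| <= M.
  by exists 1 => y; rewrite ger0_norm ?occupation_ge0// occupation_le1.
have := @mp_generator _ _ _ X _ x bf; apply: cvg_trans.
apply: near_eq_cvg; near=> h.
have h0 : 0 <= h by near: h; exact: nbhs_right_ge.
by rewrite /= [t + h]addrC occupation_markov.
Unshelve. all: by end_near.
Qed.

(** A process with a generator stays at its starting point with probability
    tending to 1, by the generator identity for the indicator of that point. *)
Lemma leave_cvg0 x :
  1 - E x (fun y => (y == x)%:R) h @[h --> (0 : R)^'+] --> (0 : R).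
Proof.
have bf : exists M : R, forall y, `|(y == x)%:R : R| <= M.
  by exists 1 => y; case: eqP => _; rewrite ?normr1 ?normr0.
pose f y : R := (y == x)%:R.
have H : - ((E x f h - f x) / h * h) @[h --> (0 : R)^'+] --> - (L f x * (0 : R)).
  apply: cvgN; apply: cvgM; first exact: (@mp_generator _ _ _ X _ x bf).
  by apply: cvg_at_right_filter; exact: cvg_id.
rewrite mulr0 oppr0 in H; apply: cvg_trans H.
apply: near_eq_cvg; near=> h.
have h0 : h != 0 by apply: lt0r_neq0; near: h; exact: nbhs_right_gt.
by rewrite /= divfK// opprB /f eqxx.
Unshelve. all: by end_near.
Qed.

(** Conditioning on the position at time h, the two probabilities differ only on
    the event that the process has left x.  The bound does not depend on t, which
    gives continuity from the left as well as from the right. *)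
Lemma occupation_modulus (B : set S) x (t h : R) : 0 <= t -> 0 <= h ->
  `|occupation B (t + h) x - occupation B t x| <=
    1 - E x (fun y => (y == x)%:R) h.
Proof.
move=> t0 h0.
have occ1 y : `|occupation B t y| <= 1.
  by rewrite ger0_norm ?occupation_ge0// occupation_le1.
pose f y : R := (y == x)%:R.
have f1 y : `|f y| <= 1 by rewrite /f; case: eqP => _; rewrite ?normr1 ?normr0.
have EE (g : S -> R) : (forall y, `|g y| <= 1) ->
    E x g h = \int[mp_law X x]_(w in setT) (g (mp_path X h w)).
  by move=> _; rewrite unlock.
have ig (g : S -> R) : (forall y, `|g y| <= 1) ->
    (mp_law X x).-integrable setT (EFin \o (g \o mp_path X h)).
  by move=> g1; exact: path_bounded_integrable g1.
have cE (c : R) : \int[mp_law X x]_(w in setT) (cst c w) = c.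
  by rewrite /cst Rintegral_cst// (_ : fine _ = 1) ?mulr1//= probability_setT.
have ic (c : R) : (mp_law X x).-integrable setT (EFin \o cst c).
  exact: finite_measure_integrable_cst.
rewrite [t + h]addrC occupation_markov// -/f !EE//.
rewrite -(cE (occupation B t x)) -{1}(cE 1) -!RintegralB//;
  [|exact: ig..].
have id : (mp_law X x).-integrable setT
    (EFin \o (fun w => occupation B t (mp_path X h w) - cst (occupation B t x) w)).
  apply: (@path_bounded_integrable (fun y => occupation B t y - occupation B t x)
    x h 2) => // y.
  by rewrite (le_trans (ler_normB _ _))// [leRHS](_ : _ = 1 + 1)// lerD.
apply: (le_trans (le_normr_Rintegral _ id)) => //.
apply: le_Rintegral => //.
- exact: integrable_norm.
- apply: (@path_bounded_integrable (fun y => 1 - f y) x h 2) => // y.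
  by rewrite (le_trans (ler_normB _ _))// [leRHS](_ : _ = 1 + 1)// lerD// normr1.
move=> w _ /=; rewrite /cst /f; case: eqP => [->|_]; first by rewrite !subrr normr0.
rewrite subr0 ler_norml; apply/andP; split.
  by rewrite lerBrDr addrC lerBlDr -[leLHS]add0r lerD ?occupation_ge0 ?occupation_le1//.
by rewrite lerBlDr -[leLHS]addr0 lerD ?occupation_ge0 ?occupation_le1//.
Qed.

Lemma occupation_left_continuous (B : set S) x (t : R) : 0 < t ->
  occupation B s x @[s --> t^'-] --> occupation B t x.
Proof.
move=> t0; apply/cvgrPdist_le => e e0.
have [d /= d0 Hd] := proj1 (cvgrPdist_le _ _) (leave_cvg0 x) e e0.
near=> s.
have s0 : 0 <= s by near: s; exact: nbhs_left_ge.
have st : s < t by near: s; exact: nbhs_left_lt.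
have ts : 0 < t - s by rewrite subr_gt0.
have := Hd (t - s); rewrite /ball_ /= !sub0r normrN gtr0_norm// normrN => Hs.
have {1}-> : t = s + (t - s) by rewrite addrC subrK.
apply: (le_trans (occupation_modulus B x s0 (ltW ts))).
apply: (le_trans (ler_norm _)); apply: Hs => //.
by rewrite ltrBlDl -ltrBlDr; near: s; apply: nbhs_left_gt; rewrite ltrBlDr ltrDl.
Unshelve. all: by end_near.
Qed.
End MarkovSemigroup.

(** * A comparison principle for linear systems with nonnegative rates *)

Lemma near_finite_forall (T : Type) (Z : choiceType) (F : set_system T)
    (S : set Z) (P : Z -> T -> Prop) : Filter F -> finite_set S ->
  (forall z, S z -> \forall x \near F, P z x) ->
  \forall x \near F, forall z, S z -> P z x.
Proof.
move=> FF /finite_fsetP[D ->] FP.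
have := @filter_bigI _ _ D P F FF FP; apply: filterS => x Px z Dz.
exact: Px.
Qed.

Section Comparison.
Context {R : realType} {Z : choiceType} {I : finType}.

(** Adding e (1 + t) to w makes the differential inequality strict.  At the last
    time up to which the perturbed function is nonnegative on S, each z where it
    vanishes has a positive right derivative, and it stays nonnegative a little
    longer; finiteness of S makes that delay uniform.  Right derivatives suffice,
    provided that w is continuous from the left. *)
Lemma comparison_principle (sigma : I -> Z -> Z) (S : set Z) (w : R -> Z -> R) :
  finite_set S -> (forall i z, S z -> S (sigma i z)) ->
  (forall z, S z -> 0 <= w 0 z) ->
  (forall t z, 0 < t -> S z -> w s z @[s --> t^'-] --> w t z) ->
  (forall t z, 0 <= t -> S z ->
    exists2 d, (w (t + h) z - w t z) / h @[h --> 0^'+] --> d &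
      \sum_i (w t (sigma i z) - w t z) <= d) ->
  forall t z, 0 <= t -> S z -> 0 <= w t z.
Proof.
move=> finS closedS w0 wcont wder T z0 T0 Sz0.
pose v e t z := w t z + e * (1 + t).
suff main e : 0 < e -> 0 <= v e T z0.
  apply/ler_addgt0Pl => e e0.
  have := main (e / (1 + T)) (divr_gt0 e0 (ltr_pwDl ltr01 T0)).
  by rewrite /v divfK ?gt_eqF ?ltr_pwDl// addrC.
move=> e0.
pose A : set R := [set t | t <= T /\
  forall s, 0 <= s <= t -> forall z, S z -> 0 <= v e s z].
have v0 z : S z -> 0 <= v e 0 z.
  by move=> Sz; rewrite /v addr0 mulr1 addr_ge0// ?w0// ltW.
have A0 : A 0 by split=> // s /le_anti <-; exact: v0.
have supA : has_sup A by split; [exists 0|exists T => t []].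
set tau := sup A.
have tau0 : 0 <= tau by exact: sup_upper_bound.
have tauT : tau <= T by apply: ge_sup => [|t []//]; exists 0.
have below s z : 0 <= s < tau -> S z -> 0 <= v e s z.
  move=> /andP[s0 st] Sz.
  have ts : 0 < tau - s by rewrite subr_gt0.
  have [t [_ At]] := sup_adherent ts supA.
  by rewrite -/tau opprB addrC subrK => /ltW st'; apply: At => //; rewrite s0.
have at_tau z : S z -> 0 <= v e tau z.
  move=> Sz; move: tau0; rewrite le_eqVlt => /orP[/eqP <-|tau_gt0]; first exact: v0.
  have cv : v e s z @[s --> tau^'-] --> v e tau z.
    apply: cvgD; first exact: wcont.
    by apply: cvgMr; apply: cvgD; [exact: cvg_cst|apply: cvg_at_left_filter; exact: cvg_id].
  rewrite -(cvg_lim (@Rhausdorff R) cv); apply: limr_ge; first by apply/cvg_ex; exists (v e tau z).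
  near=> s; apply: below => //; apply/andP; split.
    by near: s; exact: nbhs_left_ge.
  by near: s; exact: nbhs_left_lt.
have [Ttau|] := leP T tau.
  have <- : tau = T by apply/le_anti; rewrite tauT Ttau.
  exact: at_tau.
move=> tau_lt.
(* Just after time tau the perturbed function is still nonnegative: where it
   vanishes at tau, its right derivative there is at least e. *)
have after : \forall h \near (0 : R)^'+, forall z, S z -> 0 <= v e (tau + h) z.
  apply: near_finite_forall => // z Sz.
  have [d cvd dge] := wder _ _ tau0 Sz.
  have vE h : h != 0 ->
      v e (tau + h) z = v e tau z + h * ((w (tau + h) z - w tau z) / h + e).
    by move=> h0; rewrite /v; field.
  have := at_tau _ Sz; rewrite le_eqVlt => /orP[/eqP vz|vz].
    have d0 : 0 <= d.
      apply: le_trans dge; apply: sumr_ge0 => i _.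
      rewrite [leRHS](_ : _ = v e tau (sigma i z) - v e tau z); last first.
        by rewrite /v; ring.
      by rewrite -vz subr0 at_tau//; exact: closedS.
    near=> h.
    have h0 : 0 < h by near: h; exact: nbhs_right_gt.
    rewrite vE ?gt_eqF// -vz add0r; apply: mulr_ge0; first exact: ltW.
    rewrite -lerBlDr sub0r; apply: ltW.
    by near: h; apply: (cvgr_gt _ cvd); rewrite (lt_le_trans _ d0)// oppr_lt0.
  have cv : h * ((w (tau + h) z - w tau z) / h + e) @[h --> (0:R)^'+] --> 0 * (d + e).
    apply: cvgM; first by apply: cvg_at_right_filter; exact: cvg_id.
    by apply: cvgD => //; exact: cvg_cst.
  rewrite mul0r in cv.
  near=> h.
  rewrite vE; last by apply: lt0r_neq0; near: h; exact: nbhs_right_gt.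
  rewrite -lerBlDl sub0r ltW//.
  by near: h; apply: (cvgr_gt _ cv); rewrite oppr_lt0.
have [d /= d0 Hd] := after.
pose r := Num.min T (tau + d / 2).
have taur : tau < r by rewrite lt_min tau_lt ltrDl divr_gt0.
suff Ar : A r by have := sup_upper_bound supA Ar; rewrite -/tau leNgt taur.
split; first by rewrite ge_min lexx.
move=> s /andP[s0 sr] z Sz; have [st|] := ltP s tau; first by rewrite below ?s0.
rewrite le_eqVlt => /orP[/eqP <-|ts]; first exact: at_tau.
have -> : s = tau + (s - tau) by rewrite addrC subrK.
apply: Hd => //=; last by rewrite subr_gt0.
rewrite sub0r normrN gtr0_norm ?subr_gt0//.
have : s <= tau + d / 2 by apply: le_trans sr _; rewrite ge_min lexx orbT.
lra.
Unshelve. all: by end_near.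
Qed.
End Comparison.

(** * The dynamics as a sum of bond maps *)

Section Stirring.
Context {R : realType} {K : nat}.
Implicit Types (xi zeta : config K) (k l : 'I_K).

(** Applied at both ends of a bond, with the contents exchanged, this describes all
    the jumps across it. *)
Definition exch (a b : int) : int :=
  if (a == 1) && (b <= 0) then 0
  else if (b == 1) && (a <= 0) then a + 1 else a.

(** Activating the bond between k and k + 1.  At most one of the two jumps across it
    is possible, so that a single deterministic map describes both. *)
Definition stir k xi : config K :=
  if (val xi k == 1) && (val xi (ordS k) <= 0) then jump xi k (ordS k)
  else if (val xi (ordS k) == 1) && (val xi k <= 0) then jump xi (ordS k) k
  else xi.

Lemma config_le1 xi k : val xi k <= 1.
Proof. exact: (forallP (valP xi)). Qed.

Lemma ordS_neq k : (1 < K)%N -> ordS k != k.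
Proof.
move=> K1; apply/eqP => /(congr1 val) /=; have := ltn_ord k.
rewrite leq_eqVlt => /orP[/eqP E|Sk]; last by rewrite modn_small//; lia.
by rewrite E modnn; lia.
Qed.

Lemma val_stir k xi j : (1 < K)%N -> val (stir k xi) j =
  if j == k then exch (val xi k) (val xi (ordS k))
  else if j == ordS k then exch (val xi (ordS k)) (val xi k) else val xi j.
Proof.
move=> /(ordS_neq k) /negbTE Skk; rewrite /stir /exch.
case: ifPn => [/andP[/eqP k1 Sk0]|_].
  rewrite val_jump// ffunE k1; case: (j == k) => //; case: (j == ordS k) => //.
  by case: ifP => // /andP[/eqP E]; rewrite E in Sk0.
case: ifPn => [/andP[/eqP Sk1 k0]|_].
  rewrite val_jump// ffunE; have [->|_] := eqVneq j (ordS k).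
    by rewrite Skk.
  by case: (j == k).
by have [->//|_] := eqVneq j k; have [->|] := eqVneq j (ordS k).
Qed.

Lemma swt_generatorE (f : config K -> R) xi :
  swt_generator f xi = \sum_(k < K) (f (stir k xi) - f xi).
Proof.
rewrite /swt_generator; under eq_bigr do rewrite big_cons big_seq1.
rewrite big_split/=.
rewrite [X in _ + X](reindex_inj (@ordS_inj K))/= -big_split/=.
apply: eq_bigr => k _; rewrite ordSK /stir.
have [/andP[/eqP _ Sk0]|_] := boolP ((val xi k == 1) && _);
  have [/andP[/eqP Sk1 _]|_] := boolP ((val xi (ordS k) == 1) && _).
- by rewrite Sk1 in Sk0.
- by rewrite mul1r mul0r addr0.
- by rewrite mul1r mul0r add0r.
- by rewrite !mul0r addr0 subrr.
Qed.

Lemma exch_le (a a' b b' : int) : a <= a' -> b <= b' -> a' <= 1 -> b' <= 1 ->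
  exch a b <= exch a' b'.
Proof.
rewrite /exch => aa bb a1 b1.
by do 4?[case: ifP => [/andP[/eqP ? ?]|?]]; lia.
Qed.

Lemma exch_sum (a b : int) : exch a b + exch b a = a + b.
Proof. by rewrite /exch; do 4?[case: ifP => [/andP[/eqP ? ?]|?]]; lia. Qed.

Lemma exch_ge (a b c : int) : c <= 0 -> c <= a -> c <= exch a b.
Proof. by rewrite /exch; do 4?[case: ifP => [/andP[/eqP ? ?]|?]]; lia. Qed.

Lemma zero_le1 : [forall k, ([ffun=> 0] : {ffun 'I_K -> int}) k <= 1].
Proof. by apply/forallP => k; rewrite ffunE. Qed.

Definition empty_config : config K :=
  exist (fun f : {ffun 'I_K -> int} => is_true [forall k, f k <= 1]) _ zero_le1.

(** Jumps never deepen a trap, so these finite sets are stable; they are where the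
    comparison principle is applied. *)
Definition ge_configs (c : nat) : set (config K) :=
  [set xi : config K | forall j, - c%:Z <= val xi j].

Lemma finite_ge_configs c : finite_set (ge_configs c).
Proof.
pose shift (g : {ffun 'I_K -> 'I_c.+2}) : {ffun 'I_K -> int} :=
  [ffun k => (g k)%:Z - c%:Z].
pose emb g : config K := insubd empty_config (shift g).
apply: (@sub_finite_set _ _ (emb @` setT)); last exact/finite_image/finite_finset.
move=> xi xic; exists [ffun k => inord `|(val xi k + c%:Z)%R|%N] => //.
rewrite /emb (_ : shift _ = val xi); first by rewrite valKd.
apply/ffunP => k; rewrite !ffunE; move: (xic k) (config_le1 xi k).
by move: (val xi k) => v ? ?; rewrite inordK; lia.
Qed.

Lemma sum_config xi :
  \sum_k val xi k = (live_particles xi)%:Z - trap_depth xi.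
Proof.
rewrite /trap_depth opprK /live_particles.
rewrite (big_morph _ PoszD (erefl 0%:Z)) -big_split/=; apply: eq_bigr => k _.
move: (config_le1 xi k); move: (val xi k) => v v1.
by case: (leP v 0) => ?; case: eqP => /= ?; lia.
Qed.

Lemma transientE xi : transient xi <->
  (exists x, val xi x < 0) /\ (0 < live_particles xi)%N.
Proof.
rewrite /transient /trap_depth /=; apply: and_iff_compat_r.
have neg k : Num.min (val xi k) 0 <= 0 :> int by rewrite ge_min lexx orbT.
split=> [|[x xneg]].
  apply: contraPP => /forallNP nox; apply/negP; rewrite -leNgt oppr_le0.
  apply: sumr_ge0 => k _; rewrite le_min lexx andbT leNgt.
  by apply/negP; exact: nox.
rewrite oppr_gt0 (bigD1 x)//= -[ltRHS]addr0 ltr_leD//; first by rewrite gt_min xneg.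
exact: sumr_le0.
Qed.

(** Every trap has depth at least 1. *)
Lemma trap_sites_le xi :
  (\sum_(k < K) (val xi k < 0)%R)%N%:Z <= trap_depth xi.
Proof.
rewrite /trap_depth -sumrN (big_morph _ PoszD (erefl 0%:Z)).
apply: ler_sum => k _; case: (leP (val xi k) 0) => ?; first by case: ltP; lia.
by case: ltP; lia.
Qed.

Hypothesis K1 : (1 < K)%N.

(** Attractiveness: moving two ordered configurations along the same bond is an
    order-preserving coupling. *)
Lemma stir_le k xi zeta : (forall j, val xi j <= val zeta j) ->
  forall j, val (stir k xi) j <= val (stir k zeta) j.
Proof.
move=> le j; rewrite !val_stir//.
by case: ifP => _; last case: ifP => _; rewrite ?exch_le ?config_le1.
Qed.

Lemma sum_stir k xi : \sum_j val (stir k xi) j = \sum_j val xi j.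
Proof.
have Sk := ordS_neq k K1.
rewrite (bigD1 k)//= (bigD1 (ordS k))//= [RHS](bigD1 k)//=.
rewrite [X in _ = _ + X](bigD1 (ordS k))//=.
rewrite !addrA; congr (_ + _).
  by rewrite !val_stir// eqxx (negbTE Sk) eqxx exch_sum.
by apply: eq_bigr => j /andP[jk jSk]; rewrite val_stir// (negbTE jk) (negbTE jSk).
Qed.

Lemma stir_ge k xi (c : int) j :
  c <= 0 -> c <= val xi j -> c <= val (stir k xi) j.
Proof.
move=> c0 le; rewrite val_stir//; case: eqVneq le => [->|_] le; first exact: exch_ge.
by case: eqVneq le => [->|_] le//; exact: exch_ge.
Qed.

Lemma ge_configs_stir c k xi : ge_configs c xi -> ge_configs c (stir k xi).
Proof. by move=> xic j; apply: stir_ge => //; lia. Qed.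

End Stirring.

(** * Product functionals of the live particles *)

Lemma is_derive_right (R : realType) (f : R -> R) (t d : R) :
  is_derive t 1 f d -> (f (t + h) - f t) / h @[h --> 0^'+] --> d.
Proof.
move=> fd; have [df <-] := fd.
apply: cvg_dnbhs_at_right.
have H : h^-1 *: (f (h *: 1 + t) - f t) @[h --> (0 : R)^'] --> 'D_1 f t.
  exact: df.
apply: cvg_trans H; apply: near_eq_cvg.
by near=> h; rewrite /= /GRing.scale/= mulr1 mulrC [h + t]addrC.
Unshelve. all: by end_near.
Qed.

Lemma is_derive_prod (R : realType) (I : finType) (f : I -> R -> R) (df : I -> R)
    (t : R) : (forall i, is_derive t 1 (f i) (df i)) ->
  is_derive t 1 (fun s => \prod_i f i s)
    (\sum_i df i * \prod_(j | j != i) f j t).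
Proof.
move=> fd.
suff main (r : seq I) : uniq r -> is_derive t 1 (fun s => \prod_(i <- r) f i s)
    (\sum_(i <- r) df i * \prod_(j <- r | j != i) f j t).
  exact: main (index_enum_uniq I).
elim: r => [_|i r IH /= /andP[ir ur]].
  rewrite big_nil (_ : (fun _ => _) = cst 1); first exact: is_derive_cst.
  by apply/funext => s; rewrite big_nil.
have := IH ur; set D := \sum_(_ <- r) _ => {}IH.
rewrite (_ : (fun _ => _) = f i * (fun s => \prod_(j <- r) f j s)); last first.
  by apply/funext => s; rewrite big_cons.
apply: (is_derive_eq (is_deriveM (fd i) IH)).
rewrite big_cons big_cons eqxx/= /D addrC scaler_sumr; congr (_ + _).
  rewrite [LHS]mulrC; congr (_ * _); rewrite big_seq [RHS]big_seq_cond.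
  by apply: eq_bigl => j; case: eqVneq => [->|]; rewrite ?(negbTE ir) ?andbT.
rewrite !big_seq; apply: eq_bigr => j jr.
rewrite big_cons ifT; last by apply: contraNneq ir => ->.
by rewrite /GRing.scale/= mulrCA.
Qed.

Section ProductFunctional.
Context {R : realType} {K : nat}.
Implicit Types (xi zeta : config K) (k l : 'I_K) (a : 'I_K -> R).

Definition live xi k : R := (val xi k == 1)%:R.

Definition prodf a xi : R := \prod_k (1 + a k * live xi k).

Definition prodf_off a xi k : R := \prod_(j | j != k) (1 + a j * live xi j).

(** The right-hand side is the part of the time derivative of the product, along
    the heat equation for a, that the bond between k and k + 1 contributes.  With P
    the product over the other sites, the difference of the two sides is
    (a_l - a_k)^2 P if both sites hold a particle; if only one does, it is a P with
    a taken at the other site when that site is a trap, and 0 when it is empty. *)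
Lemma prodf_stir_le a k xi : (1 < K)%N -> (forall j, -1 <= a j) ->
  (forall j, val xi j < 0 -> 0 <= a j) ->
  prodf a (stir k xi) - prodf a xi <= (a (ordS k) - a k) *
    (live xi k * prodf_off a xi k -
     live xi (ordS k) * prodf_off a xi (ordS k)).
Proof.
move=> K1 a1 atrap; set l := ordS k; have lk : l != k by exact: ordS_neq.
pose P := \prod_(j | (j != k) && (j != l)) (1 + a j * live xi j).
have P0 : 0 <= P.
  apply: prodr_ge0 => j _; rewrite /live; case: eqP => _; rewrite ?mulr1 ?mulr0.
    by rewrite -lerBlDl sub0r.
  by rewrite addr0.
have prodfE zeta : prodf a zeta = (1 + a k * live zeta k) *
    ((1 + a l * live zeta l) *
     \prod_(j | (j != k) && (j != l)) (1 + a j * live zeta j)).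
  by rewrite /prodf (bigD1 k)//= (bigD1 l).
have PE : \prod_(j | (j != k) && (j != l)) (1 + a j * live (stir k xi) j) = P.
  apply: eq_bigr => j /andP[jk jl].
  by rewrite /live val_stir// (negbTE jk) (negbTE jl).
have -> : prodf_off a xi k = (1 + a l * live xi l) * P by rewrite /prodf_off (bigD1 l).
have -> : prodf_off a xi l = (1 + a k * live xi k) * P.
  rewrite /prodf_off (bigD1 k) 1?eq_sym//=; congr (_ * _).
  by apply: eq_bigl => j; rewrite andbC.
rewrite !prodfE PE -/P.
have := atrap l; have := atrap k.
rewrite /live !val_stir// eqxx (negbTE lk) -/l eqxx.
move: (config_le1 xi k) (config_le1 xi l) => /=.
move: (val xi k) (val xi l) => u v u1 v1 uneg vneg.
rewrite /exch; case: (eqVneq u 1) uneg u1 => [->|u1] uneg u1'.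
  case: (eqVneq v 1) vneg v1 => [->|v1] vneg v1'.
    rewrite /= !mulr1 subrr.
    rewrite [leRHS](_ : _ = (a l - a k) ^+ 2 * P); last by ring.
    by rewrite mulr_ge0// sqr_ge0.
  have v0 : v <= 0 by lia.
  rewrite v0 /=.
  have [->|vn0] := eqVneq v 0.
    by rewrite add0r /= le_eqVlt; apply/orP; left; apply/eqP; ring.
  have -> : v + 1 == 1 = false by apply/negP => /eqP; lia.
  have al : 0 <= a l by apply: vneg; lia.
  rewrite /= -subr_ge0 [leRHS](_ : _ = a l * P); last by ring.
  by rewrite mulr_ge0.
have u0 : u <= 0 by lia.
case: (eqVneq v 1) vneg v1 => [->|v1] vneg v1'.
  rewrite u0 /=.
  have [->|un0] := eqVneq u 0.
    by rewrite add0r /= le_eqVlt; apply/orP; left; apply/eqP; ring.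
  have -> : u + 1 == 1 = false by apply/negP => /eqP; lia.
  have ak : 0 <= a k by apply: uneg; lia.
  rewrite /= -subr_ge0 [leRHS](_ : _ = a k * P); last by ring.
  by rewrite mulr_ge0.
rewrite /= (negbTE u1) (negbTE v1) !mulr0 !mul0r.
by rewrite !subrr mulr0.
Qed.

Lemma sum_by_parts a (G : 'I_K -> R) :
  \sum_k (a (ordS k) - a k) * (G k - G (ordS k)) =
  \sum_k (a (ordS k) + a (ord_pred k) - 2 * a k) * G k.
Proof.
transitivity (\sum_k (a (ordS k) - a k) * G k + \sum_k (a k - a (ordS k)) * G (ordS k)).
  by rewrite -big_split/=; apply: eq_bigr => k _; ring.
pose H k := (a (ord_pred k) - a k) * G k.
rewrite (_ : \sum_k (a k - _) * _ = \sum_k H k); last first.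
  by rewrite [RHS](reindex_inj (@ordS_inj K)); apply: eq_bigr => k _; rewrite /H ordSK.
rewrite -big_split/=.
by apply: eq_bigr => k _; rewrite /H; ring.
Qed.

End ProductFunctional.

(** * Cosine profiles on the ring *)

Section Profile.
Context {R : realType} {K : nat}.
Implicit Types (k l x : 'I_K) (theta : R).

(** For d between 0 and K this is symmetric about K / 2, so that it closes up
    around the ring; it satisfies the eigenvalue equation of the discrete Laplacian
    except at the point where it closes. *)
Definition bump theta (d : nat) : R := cos (theta * (d%:R - K%:R / 2)).

(** The bump as a function of the distance from x to k in the direction of
    increasing sites. *)
Definition profile theta x k : R := bump theta ((k + (K - x)) %% K).

Definition decay_rate theta : R := 2 * (1 - cos theta).

Lemma bumpK theta : bump theta K = bump theta 0.
Proof. by rewrite /bump sub0r mulrN cosN; congr (cos (_ * _)); lra. Qed.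

Lemma bump_rec theta d : bump theta d.+2 + bump theta d =
  2 * cos theta * bump theta d.+1.
Proof.
rewrite /bump; set y := theta * (d.+1%:R - _).
have -> : theta * (d.+2%:R - K%:R / 2) = y + theta by rewrite /y -!natr1; ring.
have -> : theta * (d%:R - K%:R / 2) = y - theta by rewrite /y -!natr1; ring.
by rewrite cosD cosB; ring.
Qed.

Hypothesis K1 : (1 < K)%N.

Lemma bump_mod theta d : (d <= K)%N -> bump theta (d %% K) = bump theta d.
Proof.
rewrite leq_eqVlt => /orP[/eqP ->|dK]; last by rewrite modn_small.
by rewrite modnn bumpK.
Qed.

Lemma profile_self theta x : profile theta x x = cos (theta * K%:R / 2).
Proof.
rewrite /profile subnKC ?modnn; last exact: ltnW.
by rewrite /bump sub0r mulrN cosN mulrA.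
Qed.

Lemma profile_ordS theta x k :
  profile theta x (ordS k) = bump theta ((k + (K - x)) %% K).+1.
Proof.
have xK := ltn_ord x.
rewrite /profile /= modnDml addSn -addn1 -modnDml addn1 bump_mod//.
by rewrite ltn_mod; lia.
Qed.

Lemma bump_sym theta d : (d <= K)%N -> bump theta (K - d) = bump theta d.
Proof.
move=> dK; rewrite /bump natrB// -[RHS]cosN; congr cos.
by field.
Qed.

Lemma profile_rec theta x k : k != x ->
  profile theta x (ordS k) + profile theta x (ord_pred k) - 2 * profile theta x k =
  - decay_rate theta * profile theta x k.
Proof.
rewrite /decay_rate.
move=> kx; have kK := ltn_ord k; have xK := ltn_ord x.
set k' := ord_pred k; have kE : k = ordS k' by rewrite ord_predK.
pose d := ((k' + (K - x)) %% K)%N.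
have dK : (d < K)%N by rewrite ltn_mod; lia.
have dE : ((k + (K - x)) %% K = d.+1 %% K)%N.
  by rewrite kE /= modnDml addSn -addn1 -modnDml addn1.
have dSK : (d.+1 < K)%N.
  rewrite ltn_neqAle dK andbT; apply: contra_neq kx => dSK.
  move: dE; rewrite dSK modnn => /eqP; rewrite -/(dvdn _ _) => /dvdnP[q Eq].
  apply: val_inj => /=; case: q Eq => [|[|q]]; rewrite ?mulSn; lia.
have -> : profile theta x k = bump theta d.+1.
  by rewrite /profile dE bump_mod// ltnW.
rewrite profile_ordS dE modn_small// [profile _ _ k']/profile -/d bump_rec.
by ring.
Qed.

Lemma profile_next theta x : profile theta x (ordS x) = bump theta 1.
Proof. by rewrite profile_ordS subnKC ?modnn// ltnW. Qed.

Lemma profile_prev theta x : profile theta x (ord_pred x) = bump theta 1.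
Proof.
have xK := ltn_ord x; set y := ord_pred x; have xE : x = ordS y by rewrite ord_predK.
pose d := ((y + (K - x)) %% K)%N.
have dK : (d < K)%N by rewrite ltn_mod; lia.
have : (d.+1 %% K = 0)%N.
  rewrite /d -addn1 modnDml addn1 -addSn -modnDml.
  have -> : (y.+1 %% K)%N = x by rewrite [in RHS]xE.
  by rewrite subnKC ?modnn// ltnW.
have [dSK|dSK] := ltnP d.+1 K; first by rewrite modn_small.
move=> _; rewrite /profile -/d (_ : d = (K - 1)%N) ?bump_sym//; last by lia.
exact: ltnW.
Qed.

(** The discrete Laplacian of the profile has zero sum over the ring, and it is
    known everywhere but at x; this evaluates the sum of the profile. *)
Lemma sum_profile theta x : decay_rate theta * \sum_k profile theta x k =
  2 * (bump theta 1 - cos theta * bump theta 0).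
Proof.
rewrite /decay_rate; have := sum_by_parts (profile theta x) (fun=> 1).
rewrite big1 => [|k _]; last by rewrite subrr mulr0.
have p0 : profile theta x x = bump theta 0.
  by rewrite /profile subnKC ?modnn// ltnW.
rewrite (bigD1 x)//= profile_next profile_prev p0.
under eq_bigr => k kx do rewrite mulr1 profile_rec// /decay_rate.
rewrite -mulr_sumr [in X in _ -> X](bigD1 x)//= p0 => H.
by lra.
Qed.

Lemma profile_le1 theta x k : profile theta x k <= 1.
Proof. exact: cos_le1. Qed.

Lemma profile_ge theta x k : 0 <= theta <= pi / K%:R ->
  cos (theta * K%:R / 2) <= profile theta x k.
Proof.
move=> /andP[theta0 thetaK].
have K0 : 0 < K%:R :> R by rewrite ltr0n; lia.
have tK : theta * K%:R <= pi by rewrite -ler_pdivlMr.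
rewrite /profile /bump; set d := (_ %% K)%N.
have dK : d%:R <= K%:R :> R by rewrite ler_nat ltnW// ltn_mod; lia.
have d0 : 0 <= d%:R :> R by [].
rewrite -[leRHS]cos_norm.
have dist : `|d%:R - K%:R / 2| <= K%:R / 2 :> R by rewrite ler_norml; apply/andP; split; lra.
have := @pi_ge0 R; set y := `|_|; set z := theta * _ / 2 => pi0.
have yz : y <= z by rewrite /y /z normrM ger0_norm// -mulrA ler_wpM2l.
have y0 : 0 <= y by exact: normr_ge0.
have zpi : z <= pi by rewrite /z; lra.
have [<-//|yz'] := eqVneq y z; apply/ltW; rewrite ltr_cos ?in_itv/=.
- by rewrite lt_neqAle yz'.
- by rewrite y0 (le_trans yz zpi).
- by rewrite (le_trans y0 yz).
Qed.

End Profile.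

(** * Comparison of occupation probabilities with supersolutions *)

Section Supersolutions.
Context {R : realType} {K : nat}.
Implicit Types (xi zeta : config K) (k l x : 'I_K).

Definition supersolution (S : set (config K)) (v : R -> config K -> R) :=
  forall (t : R) xi, 0 <= t -> S xi ->
    exists2 d : R, is_derive t 1 (v ^~ xi) d & swt_generator (v t) xi <= d.

Lemma supersolution_affine (S : set (config K)) (A B : R)
    (v : 'I_K -> R -> config K -> R) : 0 <= B ->
  (forall x, supersolution S (v x)) ->
  supersolution S (fun t xi => A + B * \sum_x v x t xi).
Proof.
move=> B0 vsup t xi t0 Sxi.
have /choice[d dP] : forall x, exists d, is_derive t 1 (v x ^~ xi) d /\
    swt_generator (v x t) xi <= d.
  by move=> x; have [d ? ?] := vsup x t xi t0 Sxi; exists d.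
exists (B * \sum_x d x).
  have H : is_derive t 1 (\sum_x v x ^~ xi) (\sum_x d x).
    by apply: is_derive_sum => x; exact: (dP x).1.
  have := is_deriveD (is_derive_cst A t 1) (is_deriveZ B H).
  rewrite add0r; congr is_derive; apply/funext => s.
  by rewrite /= fct_sumE.
rewrite [leLHS](_ : _ = B * \sum_x swt_generator (v x t) xi).
  by rewrite ler_wpM2l// ler_sum// => x _; exact: (dP x).2.
rewrite swt_generatorE; under [in RHS]eq_bigr do rewrite swt_generatorE.
rewrite exchange_big/= [RHS]mulr_sumr; apply: eq_bigr => k _.
by rewrite sumrB; ring.
Qed.

(** The starting time t0 allows v to be compared with a process already running,
    which is how two stages are chained. *)
Lemma occupation_comparison (X : swt R K) (B S : set (config K))
    (v : R -> config K -> R) (t0 : R) : 0 <= t0 -> finite_set S ->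
  (forall k xi, S xi -> S (stir k xi)) -> supersolution S v ->
  (forall xi, S xi -> occupation X B t0 xi <= v 0 xi) ->
  forall t xi, 0 <= t -> S xi -> occupation X B (t0 + t) xi <= v t xi.
Proof.
move=> t00 finS closedS vsup init t1 xi1 t10 Sxi1; rewrite -subr_ge0.
apply: (@comparison_principle R _ _ (@stir K) S
  (fun t xi => v t xi - occupation X B (t0 + t) xi)) => //.
- by move=> xi Sxi; rewrite addr0 subr_ge0; exact: init.
- move=> t xi tpos Sxi; have [d vd _] := vsup t xi (ltW tpos) Sxi.
  apply: cvgB.
    apply: cvg_at_left_filter; apply: differentiable_continuous.
    exact/derivable1_diffP.
  apply: (@cvg_comp _ _ _ (fun s => t0 + s) (occupation X B ^~ xi) _ ((t0 + t)^'-)).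
    move=> P [e /= e0 eP]; exists e => //= s ts st; apply: eP => /=.
      by rewrite [X in `|X|](_ : _ = t - s)//; ring.
    by rewrite ltrD2l.
  exact/occupation_left_continuous/ltr_wpDl.
- move=> t xi tpos Sxi; have [d vd dge] := vsup t xi tpos Sxi.
  have tt0 : 0 <= t0 + t by exact: addr_ge0.
  exists (d - swt_generator (occupation X B (t0 + t)) xi).
    have H : (v (t + h) xi - v t xi) / h - (occupation X B (t0 + t + h) xi -
        occupation X B (t0 + t) xi) / h @[h --> (0 : R)^'+] -->
        d - swt_generator (occupation X B (t0 + t)) xi.
      apply: cvgB; first exact: (is_derive_right vd).
      exact: occupation_right_derivative.
    apply: cvg_trans H; apply: near_eq_cvg; near=> h.
    by rewrite /= addrA; ring.
  rewrite [leLHS](_ : _ = swt_generator (v t) xi -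
      swt_generator (occupation X B (t0 + t)) xi); last first.
    by rewrite !swt_generatorE -sumrB; apply: eq_bigr => k _; ring.
  by rewrite lerD2r.
Unshelve. all: by end_near.
Qed.

End Supersolutions.

(** * Product supersolutions *)

Section ProductSupersolutions.
Context {R : realType} {K : nat}.
Hypothesis K1 : (1 < K)%N.
Implicit Types (xi zeta : config K) (k l x : 'I_K).

Definition decay (mu c : R) (phi : 'I_K -> R) (t : R) (k : 'I_K) : R :=
  c * expR (- (mu * t)) * phi k.

(** Summation by parts turns the bondwise bounds into the heat equation satisfied
    by a, which is only needed at sites holding a live particle, hence not at x. *)
Lemma prodf_decay_derive mu c (phi : 'I_K -> R) x xi (t : R) :
  (forall k, k != x ->
     phi (ordS k) + phi (ord_pred k) - 2 * phi k = - mu * phi k) ->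
  val xi x != 1 ->
  (forall j, -1 <= decay mu c phi t j) ->
  (forall j, val xi j < 0 -> 0 <= decay mu c phi t j) ->
  exists2 d : R, is_derive t 1 (fun s => prodf (decay mu c phi s) xi) d &
    swt_generator (prodf (decay mu c phi t)) xi <= d.
Proof.
move=> phiE xix a1 atrap; set a := decay mu c phi t.
exists (\sum_k (- mu * a k * live xi k) * prodf_off a xi k).
  rewrite /prodf_off; apply: (is_derive_prod (f := fun k s =>
    1 + decay mu c phi s k * live xi k)) => k.
  have dlin : is_derive t 1 (fun s : R => - (mu * s)) (- mu).
    have := is_deriveN (is_deriveZ mu (is_derive_id t 1)).
    by rewrite /GRing.scale/= mulr1.
  have dexp : is_derive t 1 (expR \o (fun s : R => - (mu * s)))
      (expR (- (mu * t)) * - mu).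
    exact: is_derive1_comp.
  have := is_deriveD (is_derive_cst (1 : R) t 1)
    (is_deriveZ (c * phi k * live xi k) dexp).
  rewrite add0r [X in is_derive _ _ _ X](_ : _ = - mu * a k * live xi k); last first.
    by rewrite /a /decay /GRing.scale/=; ring.
  congr is_derive; apply/funext => s.
  by rewrite !fctE /decay /= /GRing.scale/=; congr (_ + _); ring.
rewrite swt_generatorE.
apply: le_trans (ler_sum _ (fun k _ => prodf_stir_le k K1 a1 atrap)) _.
rewrite -/a (sum_by_parts a (fun k => live xi k * prodf_off a xi k)).
apply: ler_sum => k _; have [->|kx] := eqVneq k x.
  by rewrite /live (negbTE xix) !(mulr0, mul0r).
rewrite [X in X * _ <= _](_ : _ = - mu * a k); first by rewrite !mulrA.
transitivity (c * expR (- (mu * t)) *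
    (phi (ordS k) + phi (ord_pred k) - 2 * phi k)); first by rewrite /a /decay; ring.
by rewrite phiE// /a /decay; ring.
Qed.

Definition trap_survival (mu c : R) (phi : 'I_K -> R) x (t : R) xi : R :=
  (val xi x < 0)%R%:R * (prodf (decay mu c phi t) xi - 1).

(** Until the trap at x fills up, this is the product functional minus 1; when it
    fills up, the functional drops from a nonnegative value to 0. *)
Lemma trap_survival_supersolution mu c (phi : 'I_K -> R) x :
  (forall k, k != x ->
     phi (ordS k) + phi (ord_pred k) - 2 * phi k = - mu * phi k) ->
  0 <= c -> (forall k, 0 <= phi k) ->
  supersolution setT (trap_survival mu c phi x).
Proof.
move=> phiE c0 phi0 t xi _ _.
have a0 s j : 0 <= decay mu c phi s j by rewrite !mulr_ge0 ?expR_ge0.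
have prod1 s zeta : 1 <= prodf (decay mu c phi s) zeta.
  apply: (big_rec (fun p => 1 <= p)) => // j p _ p1.
  by rewrite -[leLHS]mul1r ler_pM// lerDl mulr_ge0// /live.
have [xneg|xpos] := ltP (val xi x) 0; last first.
  exists 0; first last.
    rewrite swt_generatorE big1// => k _; rewrite /trap_survival.
    by rewrite !ltNge xpos stir_ge//= !mul0r subrr.
  rewrite (_ : _ ^~ xi = cst 0); first exact: is_derive_cst.
  by apply/funext => s; rewrite /trap_survival ltNge xpos mul0r.
have x1 : val xi x != 1 by apply/eqP => E; rewrite E in xneg.
have [||d dd dge] := @prodf_decay_derive mu c phi x xi t phiE x1.
- by move=> j; rewrite (le_trans _ (a0 t j))// oppr_le0.
- by [].
exists d.
  rewrite (_ : _ ^~ xi = (fun s => prodf (decay mu c phi s) xi) - cst 1).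
    by apply: (is_derive_eq (is_deriveB dd (is_derive_cst _ _ _))); rewrite subr0.
  by apply/funext => s; rewrite /trap_survival xneg mul1r.
apply: le_trans dge; rewrite !swt_generatorE; apply: ler_sum => k _.
rewrite /trap_survival xneg mul1r opprB addrA lerD2r -lerBrDr.
(* Filling the trap at x turns a nonnegative quantity into 0. *)
by case: (_ < _); rewrite ?mul1r// mul0r subr_ge0.
Qed.

(** Configurations whose only trap is at x and is too deep to be filled by the
    live particles; this is stable because the sum is conserved. *)
Definition one_trap x : set (config K) :=
  [set xi : config K | (forall j, j != x -> 0 <= val xi j) /\ \sum_j val xi j < 0].

Lemma one_trap_neg x xi : one_trap x xi -> val xi x < 0.
Proof.
move=> [pos]; rewrite (bigD1 x)//= => neg; apply: le_lt_trans neg.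
by rewrite lerDl sumr_ge0.
Qed.

Lemma one_trap_stir x k xi : one_trap x xi -> one_trap x (stir k xi).
Proof.
move=> [pos neg]; split; last by rewrite sum_stir.
by move=> j jx; apply: stir_ge => //; exact: pos.
Qed.

(** With c = - 1 and a profile vanishing at x, the product is nonnegative, and equal
    to 1 when no particle is alive: at time 0 it dominates the indicator of
    extinction. *)
Lemma emptiness_supersolution mu (phi : 'I_K -> R) x :
  (forall k, k != x ->
     phi (ordS k) + phi (ord_pred k) - 2 * phi k = - mu * phi k) ->
  0 <= mu -> (forall k, 0 <= phi k <= 1) -> phi x = 0 ->
  supersolution (one_trap x) (fun t => prodf (decay mu (-1) phi t)).
Proof.
move=> phiE mu0 phi01 phix t xi t0 xiS.
have xneg := one_trap_neg xiS.
have x1 : val xi x != 1 by apply/eqP => E; rewrite E in xneg.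
apply: (prodf_decay_derive phiE x1) => j.
  have /andP[p0 p1] := phi01 j; rewrite /decay mulN1r mulNr lerN2.
  by rewrite mulr_ile1 ?expR_ge0// -expR0 ler_expR oppr_le0 mulr_ge0.
have [->|jx] := eqVneq j x; first by rewrite /decay phix mulr0.
by rewrite ltNge (xiS.1 _ jx).
Qed.

End ProductSupersolutions.

(** * Survival from a full configuration around one trap *)

Section LowerBound.
Context {R : realType} {K : nat}.
Hypothesis K1 : (1 < K)%N.
Variable X : swt R K.
Implicit Types (xi zeta : config K) (k l x : 'I_K).

Lemma occupation_setC (B : set (config K)) t xi : 0 <= t ->
  occupation X (~` B) t xi = 1 - occupation X B t xi.
Proof.
move=> t0; have mB := mp_measurable X B t0.
rewrite /occupation preimage_setC probability_setC// fineB//.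
exact: prob_fin_num.
Qed.

Lemma live_particlesE xi : (live_particles xi)%:R = \sum_k live xi k :> R.
Proof. by rewrite /live_particles natr_sum. Qed.

Definition full_config x : config K := insubd empty_config
  ([ffun k => if k == x then - K%:Z else 1] : {ffun 'I_K -> int}).

Lemma val_full_config x k :
  val (full_config x) k = if k == x then - K%:Z else 1.
Proof.
rewrite /full_config val_insubd ifT ?ffunE//.
by apply/forallP => j; rewrite ffunE; case: ifP => _; lia.
Qed.

Lemma full_config_one_trap x : one_trap x (full_config x).
Proof.
split=> [j /negbTE jx|]; first by rewrite val_full_config jx.
rewrite (bigD1 x)//= val_full_config eqxx.
under eq_bigr => j /negbTE jx do rewrite val_full_config jx.
have : \sum_(j < K) (1 : int) = K%:Z by rewrite sumr_const card_ord natz.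
rewrite (bigD1 x)//=; move: (\sum_(_ < _ | _) _) => s; lia.
Qed.

(** Here transience is the presence of a live particle.  The product functional
    bounds the probability of the complement, and each factor 1 - y is at most
    exp (- y). *)
Lemma occupation_transient_ge x t : 0 <= t ->
  1 - expR (- (expR (- (decay_rate (pi / K%:R) * t)) * \sum_k profile (pi / K%:R) x k)) <=
  occupation X (@transient K) t (full_config x).
Proof.
move=> t0; set lambda := decay_rate _; set phi := profile (pi / K%:R) x; set xi := full_config x.
have K0 : 0 < K%:R :> R by rewrite ltr0n; lia.
have thetaK : 0 <= (pi / K%:R : R) <= pi / K%:R by rewrite divr_ge0 ?pi_ge0//=.
have half : cos (pi / K%:R * K%:R / 2) = 0 :> R.
  by rewrite divfK ?gt_eqF// cos_pihalf.
have phi01 k : 0 <= phi k <= 1.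
  by rewrite profile_le1 andbT -half; exact: profile_ge.
have phix : phi x = 0 by rewrite /phi profile_self.
have lambda0 : 0 <= lambda by rewrite mulr_ge0// subr_ge0 cos_le1.
have phiE k : k != x ->
    phi (ordS k) + phi (ord_pred k) - 2 * phi k = - lambda * phi k.
  by move=> kx; rewrite profile_rec.
pose S := one_trap x `&` ge_configs (K := K) K.
have init zeta : S zeta ->
    occupation X (~` (@transient K)) 0 zeta <=
      prodf (decay lambda (-1) phi 0) zeta.
  move=> [zx _]; rewrite occupation0.
  have fac k : 0 <= 1 + decay lambda (-1) phi 0 k * live zeta k.
    rewrite /decay mulr0 oppr0 expR0 mulr1 mulN1r mulNr subr_ge0.
    have /andP[p0 p1] := phi01 k.
    by rewrite /live; case: (_ == _); rewrite ?mulr1 ?mulr0.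
  case: (boolP (_ \in _)) => [/set_mem/= nt|_]; last exact: prodr_ge0.
  rewrite /prodf big1// => k _; rewrite /live; case: eqP => [k1|]; last by rewrite mulr0 addr0.
  exfalso; apply: nt; apply/transientE; split.
    by exists x; exact: one_trap_neg zx.
  by rewrite /live_particles (bigD1 k)//= k1.
have xiS : S xi.
  split; first exact: full_config_one_trap.
  by move=> k; rewrite val_full_config; case: ifP => _; lia.
have closedS k zeta : S zeta -> S (stir k zeta).
  by move=> [? ?]; split; [exact: one_trap_stir|exact: ge_configs_stir].
have finS : finite_set S.
  by apply: sub_finite_set; [exact: subIsetr|exact: finite_ge_configs].
have supS : supersolution S (fun t => prodf (decay lambda (-1) phi t)).
  move=> s zeta s0 [zx _].
  exact: (emptiness_supersolution K1 phiE lambda0 phi01 phix s0 zx).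
have := occupation_comparison (X := X) (lexx 0) finS closedS supS init t0 xiS.
rewrite add0r occupation_setC// => H.
suff : prodf (decay lambda (-1) phi t) xi <=
    expR (- (expR (- (lambda * t)) * \sum_k phi k)) by lra.
rewrite mulr_sumr -sumrN expR_sum; apply: ler_prod => k _.
have -> : 1 + decay lambda (-1) phi t k * live xi k =
    1 - expR (- (lambda * t)) * phi k.
  rewrite /decay /live val_full_config; have [->|_] := eqVneq k x.
    by rewrite phix !mulr0 mul0r oppr0.
  by rewrite eqxx mulr1; ring.
rewrite expR_ge1Dx andbT subr_ge0 mulr_ile1 ?expR_ge0//; last 3 first.
- by have /andP[] := phi01 k.
- by rewrite -expR0 ler_expR oppr_le0 mulr_ge0.
- by have /andP[] := phi01 k.
Qed.

End LowerBound.

(** * Extinction in two stages *)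

Lemma expR_ge1 (R : realType) (x : R) : (1 <= expR x) = (0 <= x).
Proof. by rewrite -[X in X <= _]expR0 ler_expR. Qed.

Section UpperBound.
Context {R : realType} {K : nat}.
Hypothesis K1 : (1 < K)%N.
Variable X : swt R K.
Implicit Types (xi zeta : config K) (k l x : 'I_K).

Local Notation u := (occupation X (@transient K)).
Local Notation N xi := ((live_particles xi)%:R : R).
Local Notation traps xi := (\sum_(x < K) (val xi x < 0)%R%:R : R).

Lemma ge_configs_all xi : exists c, ge_configs c xi.
Proof.
exists (\sum_k `|val xi k|)%N => j; rewrite (bigD1 j)//= PoszD.
by move: (\sum_(_ < _ | _) _)%N (val xi j) => n v; lia.
Qed.

(** When the sum is nonpositive, a live particle forces a trap, so transience means
    that a live particle is left, which is an increasing event.  The comparison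
    principle is applied to pairs of configurations moved by the same bonds. *)
Lemma occupation_transient_le xi zeta t : 0 <= t ->
  (forall k, val xi k <= val zeta k) -> \sum_k val zeta k <= 0 ->
  u t xi <= u t zeta.
Proof.
move=> t0 le zeta0.
have [c xic] := ge_configs_all xi.
have zetac : ge_configs c zeta by move=> k; exact: le_trans (xic k) (le k).
pose S : set (config K * config K) := [set p : config K * config K |
  [/\ forall k, val p.1 k <= val p.2 k, \sum_k val p.2 k <= 0,
      ge_configs c p.1 & ge_configs c p.2]].
pose sigma k (p : config K * config K) := (stir k p.1, stir k p.2).
rewrite -subr_ge0.
apply: (@comparison_principle R _ _ sigma S (fun t p => u t p.2 - u t p.1)
  _ _ _ _ _ t (xi, zeta)) => //.
- apply: (@sub_finite_set _ _ (ge_configs c `*` ge_configs c)).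
    by move=> p [].
  by apply: finite_setX; exact: finite_ge_configs.
- move=> k p [ple psum pc1 pc2]; split=> /=.
  + exact: stir_le.
  + by rewrite sum_stir.
  + exact: ge_configs_stir.
  + exact: ge_configs_stir.
- move=> [xi' zeta'] [/= ple psum _ _]; rewrite subr_ge0 !occupation0.
  case: (boolP (xi' \in _)) => [/set_mem xiT|_]; last by case: (_ \in _).
  suff zT : zeta' \in @transient K by rewrite zT.
  apply: mem_set; have [_ Nxi] := xiT.
  have Nle : (live_particles xi' <= live_particles zeta')%N.
    apply: leq_sum => k _; move: (ple k) (config_le1 zeta' k).
    move: (val xi' k) (val zeta' k) => v w vw w1.
    by case: eqP => // v1; case: eqP => // ?; lia.
  by move: psum; rewrite sum_config => psum; split; lia.
- move=> s p s0 _; apply: cvgB; exact: occupation_left_continuous.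
- move=> s p s0 _; exists (swt_generator (u s) p.2 - swt_generator (u s) p.1).
    have H : (u (s + h) p.2 - u s p.2) / h - (u (s + h) p.1 - u s p.1) / h
        @[h --> (0 : R)^'+] --> swt_generator (u s) p.2 - swt_generator (u s) p.1.
      by apply: cvgB; exact: occupation_right_derivative.
    by apply: cvg_trans H; apply: near_eq_cvg; near=> h; rewrite /=; ring.
  rewrite !swt_generatorE -sumrB; apply: ler_sum => k _; rewrite /sigma /=.
  by rewrite le_eqVlt; apply/orP; left; apply/eqP; ring.
Unshelve. all: by end_near.
Qed.

Lemma fill_to_zero xi : \sum_k val xi k <= 0 ->
  exists2 zeta : config K, (forall k, val xi k <= val zeta k) & \sum_k val zeta k = 0.
Proof.
have [n] := ubnP `|(\sum_k val xi k)%R|%N; elim: n xi => // n IH xi.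
move=> len sum0; have [E|sn0] := eqVneq (\sum_k val xi k) 0; first by exists xi.
have [x xneg] : exists x, val xi x < 0.
  apply: contrapT => /forallNP nox; move/negP: sn0; apply.
  by rewrite eq_le sum0 sumr_ge0// => k _; rewrite leNgt; apply/negP; exact: nox.
pose f : {ffun 'I_K -> int} :=
  [ffun k => if k == x then val xi x + 1 else val xi k].
have fle : [forall k, f k <= 1].
  apply/forallP => k; rewrite ffunE; case: ifP => _; last exact: config_le1.
  by lia.
pose xi' : config K := insubd xi f.
have xi'E k : val xi' k = if k == x then val xi x + 1 else val xi k.
  by rewrite val_insubd fle ffunE.
have sumE : \sum_k val xi' k = \sum_k val xi k + 1.
  rewrite (bigD1 x)//= [in RHS](bigD1 x)//= xi'E eqxx -addrA [1 + _]addrC addrA.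
  congr (_ + _ + _); apply: eq_bigr => k /negbTE kx; by rewrite xi'E kx.
have [|| zeta le sumz] := IH xi'.
- by rewrite sumE; lia.
- by rewrite sumE; lia.
exists zeta => // k; apply: le_trans (le k); rewrite xi'E.
by case: eqVneq => [->|//]; lia.
Qed.


Section Gauge.
Variables theta c : R.
Hypothesis theta_bounds : 0 <= theta <= pi / K%:R.
Hypothesis c_ge0 : 0 <= c.
Hypothesis c_big : expR 1 <= 1 + c * cos (theta * K%:R / 2).

Local Notation mu := (decay_rate theta).

(** For c large enough this dominates, at time 0, the number of traps times e^N - 1,
    and so, at time t, the expectation of that quantity for the process. *)
Definition survival t xi : R :=
  \sum_x trap_survival mu c (profile theta x) x t xi.

Lemma half_angle_ge0 : 0 <= cos (theta * K%:R / 2) :> R.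
Proof.
have /andP[th0 thK] := theta_bounds; have K0 : 0 < K%:R :> R by rewrite ltr0n; lia.
have tK : theta * K%:R <= pi by rewrite -ler_pdivlMr.
have tK0 : 0 <= theta * K%:R by rewrite mulr_ge0// ltW.
by apply: cos_ge0_pihalf; have := @pi_ge0 R; lra.
Qed.

Lemma profile_ge0 x k : 0 <= profile theta x k.
Proof. by apply: (le_trans half_angle_ge0); exact: profile_ge. Qed.

Lemma survival_supersolution (A B : R) (S : set (config K)) : 0 <= B ->
  supersolution S (fun t xi => A + B * survival t xi).
Proof.
move=> B0 t xi t0 _.
apply: (@supersolution_affine R K setT A B
  (fun x => trap_survival mu c (profile theta x) x)) => // x.
apply: trap_survival_supersolution => // [k kx|k]; last exact: profile_ge0.
by rewrite profile_rec.
Qed.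

Lemma survival_ge xi : traps xi * (expR (N xi) - 1) <= survival 0 xi.
Proof.
rewrite mulr_suml; apply: ler_sum => x _; apply: ler_wpM2l => //.
rewrite lerD2r live_particlesE expR_sum; apply: ler_prod => k _.
rewrite expR_ge0/= /decay mulr0 oppr0 expR0 mulr1 /live.
case: (_ == _); rewrite ?mulr1 ?mulr0 ?expR0 ?addr0//.
by apply: (le_trans c_big); rewrite lerD2l ler_wpM2l// profile_ge.
Qed.

Lemma survival_le t xi :
  survival t xi <= traps xi * (expR (c * expR (- (mu * t)) * N xi) - 1).
Proof.
rewrite mulr_suml; apply: ler_sum => x _; apply: ler_wpM2l => //.
rewrite lerD2r live_particlesE mulr_sumr expR_sum; apply: ler_prod => k _.
have dec0 : 0 <= c * expR (- (mu * t)) by rewrite mulr_ge0 ?expR_ge0.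
have y0 : 0 <= decay mu c (profile theta x) t k.
  by rewrite mulr_ge0 ?profile_ge0.
have l0 : 0 <= live xi k :> R by rewrite /live.
apply/andP; split; first by rewrite addr_ge0// mulr_ge0.
apply: (le_trans (expR_ge1Dx _)).
by rewrite ler_expR ler_wpM2r// /decay -[leRHS]mulr1 ler_wpM2l// profile_le1.
Qed.

Lemma survival_ge0 t xi : 0 <= survival t xi.
Proof.
apply: sumr_ge0 => x _; rewrite mulr_ge0// subr_ge0 /prodf.
apply: (big_rec (fun p => 1 <= p)) => // j p _ p1.
rewrite -[leLHS]mul1r ler_pM// lerDl mulr_ge0//.
by rewrite !mulr_ge0 ?expR_ge0 ?profile_ge0.
Qed.

(** One stage only, a union bound over the initial traps. *)
Lemma occupation_le_survival t xi : 0 <= t -> u t xi <= survival t xi.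
Proof.
move=> t0; have [b xib] := ge_configs_all xi.
have init zeta : ge_configs b zeta -> u 0 zeta <= 0 + 1 * survival 0 zeta.
  move=> _; rewrite add0r mul1r occupation0.
  case: (boolP (_ \in _)) => [/set_mem/transientE[[x xneg] Npos]|_]; last exact: survival_ge0.
  apply: le_trans (survival_ge zeta).
  rewrite -[leLHS]mulr1; apply: ler_pM => //.
    by rewrite (bigD1 x)//= xneg lerDl sumr_ge0.
  rewrite lerBrDr; apply: le_trans (expR_ge1Dx _).
  by rewrite lerD2l ler1n.
have supS : supersolution (ge_configs b) (fun t xi => 0 + 1 * survival t xi).
  exact: survival_supersolution.
have := occupation_comparison (X := X) (lexx 0) (finite_ge_configs b)
  (ge_configs_stir K1 (c := b)) supS init t0 xib.
by rewrite !add0r mul1r.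
Qed.

Lemma traps_le xi : 0 <= \sum_k val xi k -> traps xi <= N xi.
Proof.
rewrite sum_config subr_ge0 => DN; rewrite -natr_sum ler_nat.
by have := le_trans (trap_sites_le xi) DN.
Qed.

(** Let y = c exp (- mu t).  From a configuration with at most M particles, hence at
    most M traps, the survival functional after time t is at most M (e^{yM} - 1).
    Having more than M particles after time s, with a trap left, costs e^{-M} times
    the exponential moment of the number of particles, summed over the traps. *)
Lemma two_stage_nonneg_sum (M s t : R) xi : 1 <= M -> 0 <= s -> 0 <= t ->
  0 <= \sum_k val xi k ->
  u (t + s) xi <= expR 1 * (c * expR (- (mu * t))) * M ^+ 2 +
    2 * expR (- M) * (K%:R * expR (c * expR (- (mu * s)) * K%:R)).
Proof.
move=> M1 s0 t0 sum0; have [b xib] := ge_configs_all xi.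
set y := c * expR (- (mu * t)); set A := expR 1 * y * M ^+ 2.
have y0 : 0 <= y by rewrite mulr_ge0 ?expR_ge0.
have M0 : 0 <= M by exact: le_trans ler01 M1.
have A0 : 0 <= A by rewrite !mulr_ge0 ?expR_ge0// sqr_ge0.
have B0 : 0 <= 2 * expR (- M) by rewrite mulr_ge0 ?expR_ge0.
pose S := [set zeta : config K | 0 <= \sum_k val zeta k] `&` ge_configs b.
have init zeta : S zeta ->
    u t zeta <= A + 2 * expR (- M) * survival 0 zeta.
  move=> [/= zsum _].
  have B1 : 0 <= 2 * expR (- M) * survival 0 zeta by rewrite mulr_ge0// survival_ge0.
  have [NM|MN] := leP (N zeta) M.
    apply: le_trans (_ : A <= _); last by rewrite lerDl.
    have [yM|yM] := leP (y * M) 1; last first.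
      apply: le_trans (occupation_le1 _ _ _ t0) _.
      rewrite [A](_ : _ = expR 1 * (y * M) * M); last by rewrite /A; ring.
      apply: mulr_ege1 => //; apply: mulr_ege1; last exact: ltW.
      by rewrite expR_ge1.
    apply: le_trans (occupation_le_survival _ t0) _.
    apply: le_trans (survival_le _ _) _; rewrite -/y.
    have yN0 : 0 <= y * N zeta by rewrite mulr_ge0.
    have yNM : y * N zeta <= y * M by rewrite ler_wpM2l.
    have E1 : expR (y * N zeta) - 1 <= expR 1 * (y * M).
      apply: (@le_trans _ _ (expR (y * N zeta) * (y * N zeta))).
        move: (y * N zeta) => z; have := expR_ge1Dx (- z); rewrite expRN.
        move: (expR z) (expR_gt0 z) => e e0.
        by rewrite -[leRHS]mul1r -ler_pdivrMr ?invr_gt0// invrK; lra.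
      by rewrite ler_pM ?expR_ge0// ler_expR (le_trans yNM).
    rewrite [A](_ : _ = M * (expR 1 * (y * M))); last by rewrite /A; ring.
    rewrite ler_pM//; first exact: sumr_ge0.
      by rewrite subr_ge0 expR_ge1.
    exact: le_trans (traps_le zsum) NM.
  have [notrap|[x xneg]] : (traps zeta = 0) \/ (exists x, val zeta x < 0).
    have [?|nox] := pselect (exists x, val zeta x < 0); [by right|left].
    rewrite big1// => x _; case: ltP => // xneg.
    by exfalso; apply: nox; exists x.
  - apply: le_trans (occupation_le_survival _ t0) _.
    apply: le_trans (survival_le _ _) _; rewrite notrap mul0r.
    by rewrite addr_ge0.
  apply: le_trans (occupation_le1 _ _ _ t0) _.
  rewrite -[leLHS]add0r lerD// -mulrA mulrCA expRN mulrC ler_pdivlMr ?expR_gt0// mul1r.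
  apply: (@le_trans _ _ (expR (N zeta))); first by rewrite ler_expR ltW.
  apply: (@le_trans _ _ (2 * (expR (N zeta) - 1))).
    have := expR_ge1Dx (N zeta); lra.
  rewrite ler_wpM2l//; apply: le_trans (survival_ge zeta).
  rewrite -[leLHS]mul1r ler_wpM2r ?subr_ge0 ?expR_ge1//.
  by rewrite (bigD1 x)//= xneg lerDl sumr_ge0.
have closedS k zeta : S zeta -> S (stir k zeta).
  by move=> [? ?]; split; [rewrite /= sum_stir|exact: ge_configs_stir].
have finS : finite_set S.
  by apply: sub_finite_set; [exact: subIsetr|exact: finite_ge_configs].
have supS : supersolution S (fun t xi => A + 2 * expR (- M) * survival t xi).
  exact: survival_supersolution.
have := occupation_comparison (X := X) t0 finS closedS supS init s0 (conj sum0 xib).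
move=> /le_trans; apply; rewrite lerD2l ler_wpM2l//; apply: le_trans (survival_le _ _) _.
have NK : N xi <= K%:R.
  rewrite live_particlesE -[X in _ <= X%:R]card_ord -sum1_card natr_sum.
  by apply: ler_sum => k _; rewrite /live; case: (_ == _).
have TK : traps xi <= K%:R.
  rewrite -[X in _ <= X%:R]card_ord -sum1_card natr_sum.
  by apply: ler_sum => k _; case: (_ < _).
have dec0 : 0 <= c * expR (- (mu * s)) by rewrite mulr_ge0 ?expR_ge0.
apply: ler_pM => //; first exact: sumr_ge0.
  by rewrite subr_ge0 expR_ge1 mulr_ge0.
rewrite lerBlDr; apply: ler_wpDr => //.
by rewrite ler_expR ler_wpM2l.
Qed.

Lemma two_stage (M s t : R) xi : 1 <= M -> 0 <= s -> 0 <= t ->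
  u (t + s) xi <= expR 1 * (c * expR (- (mu * t))) * M ^+ 2 +
    2 * expR (- M) * (K%:R * expR (c * expR (- (mu * s)) * K%:R)).
Proof.
move=> M1 s0 t0; have [sum0|sum0] := leP 0 (\sum_k val xi k).
  exact: two_stage_nonneg_sum.
have [zeta le zsum] := fill_to_zero (ltW sum0).
apply: le_trans (two_stage_nonneg_sum M1 s0 t0 (_ : 0 <= \sum_k val zeta k)).
  by apply: occupation_transient_le => //; [exact: addr_ge0|rewrite zsum].
by rewrite zsum.
Qed.

End Gauge.

End UpperBound.

(** * Estimates on the decay rate *)

Section TrigonometricBounds.
Context {R : realType}.
Implicit Types x : R.

Lemma ge0_of_derive_ge0 (f df : R -> R) : f 0 = 0 ->
  (forall x, is_derive x 1 f (df x)) -> (forall x, 0 <= x -> 0 <= df x) ->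
  forall x, 0 <= x -> 0 <= f x.
Proof.
move=> f0 fd df0 x x0.
have [|c] := @MVT_segment _ f df 0 x x0 (fun y _ => fd y).
  by apply: derivable_within_continuous => y _; have [] := fd y.
rewrite in_itv/= f0 !subr0 => /andP[c0 _] ->.
by rewrite mulr_ge0// df0.
Qed.

Lemma sin_leid x : 0 <= x -> sin x <= x.
Proof.
move=> x0; rewrite -subr_ge0.
apply: (@ge0_of_derive_ge0 (id - sin) (fun y => 1 - cos y)) => //.
by rewrite !fctE sin0 subr0.
Qed.

Lemma cos_ge_quadratic x : 0 <= x -> 1 - x ^+ 2 / 2 <= cos x.
Proof.
move=> x0; rewrite -subr_ge0.
apply: (@ge0_of_derive_ge0 (fun y => cos y - (1 - y ^+ 2 / 2))
  (fun y => y - sin y)) => // [|y|y y0].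
- by rewrite cos0; lra.
- have -> : (fun y : R => cos y - (1 - y ^+ 2 / 2)) =
      cos - (cst 1 - 2^-1 *: (id ^+ 2)).
    by apply/funext => z; rewrite !fctE /GRing.scale/= mulrC.
  by apply: is_derive_eq; rewrite /GRing.scale/= !mulr1 expr1; lra.
- by rewrite subr_ge0 sin_leid.
Qed.

Lemma sin_ge_cubic x : 0 <= x -> x - x ^+ 3 / 6 <= sin x.
Proof.
move=> x0; rewrite -subr_ge0.
apply: (@ge0_of_derive_ge0 (fun y => sin y - (y - y ^+ 3 / 6))
  (fun y => cos y - (1 - y ^+ 2 / 2))) => // [|y|y y0].
- by rewrite sin0; lra.
- have -> : (fun y : R => sin y - (y - y ^+ 3 / 6)) =
      sin - (id - 6^-1 *: (id ^+ 3)).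
    by apply/funext => z; rewrite !fctE /GRing.scale/= mulrC.
  by apply: is_derive_eq; rewrite /GRing.scale/= !mulr1; lra.
- by rewrite subr_ge0 cos_ge_quadratic.
Qed.

Lemma pi_lt4 : pi < 4 :> R.
Proof. by have := @pihalf_lt2 R; lra. Qed.

Lemma sin_ge_third x : 0 <= x <= pi / 2 -> x / 3 <= sin x.
Proof.
move=> /andP[x0 xpi]; apply: le_trans (sin_ge_cubic x0).
have x2 : x <= 2 by have := @pihalf_lt2 R; lra.
have : x * x <= 4 by nra.
by rewrite !exprS expr0 => xx; nra.
Qed.

End TrigonometricBounds.

Section RateEstimates.
Context {R : realType}.
Implicit Types theta : R.

Lemma decay_rate_le theta : 0 <= theta -> decay_rate theta <= theta ^+ 2.
Proof. by move=> t0; have := cos_ge_quadratic t0; rewrite /decay_rate; lra. Qed.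

Lemma decay_rate_ge theta : 0 <= theta <= 2 ->
  theta ^+ 2 * (1 - theta ^+ 2 / 12) <= decay_rate theta.
Proof.
move=> /andP[t0 t2]; set z := theta / 2.
have z0 : 0 <= z by rewrite divr_ge0.
have z1 : z <= 1 by rewrite /z; lra.
have thetaE : theta = z *+ 2 by rewrite -mulr_natr divfK.
rewrite /decay_rate thetaE cos_mulr2n cos2sin2 -mulr_natr.
have := sin_ge_cubic z0; move: (sin z) => s sz.
have z2 : 0 <= 1 - z ^+ 2 / 6 by nra.
have w0 : 0 <= z * (1 - z ^+ 2 / 6) by rewrite mulr_ge0.
have : (z * (1 - z ^+ 2 / 6)) ^+ 2 <= s ^+ 2.
  by rewrite lerXn2r ?nnegrE//; [apply: le_trans sz|]; lra.
have : 0 <= (z ^+ 3) ^+ 2 by exact: sqr_ge0.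
lra.
Qed.

Lemma ln2_ge_half : 2^-1 <= ln 2 :> R.
Proof.
have := @le_ln1Dx R (- 2^-1); rewrite [1 + _](_ : _ = 2^-1); last by lra.
by rewrite lnV ?posrE//; lra.
Qed.

Variable K : nat.
Hypothesis K1 : (1 < K)%N.

Local Notation L := (ln K%:R : R).

Lemma lnK_ge_half : 2^-1 <= L.
Proof.
by apply: (le_trans ln2_ge_half); rewrite ler_ln ?posrE ?ler_nat ?ltr0n//; lia.
Qed.

Lemma lnK_le : L <= K%:R.
Proof. by rewrite ltW// ln_sublinear// ltr0n; lia. Qed.

(** The angle (1 - r) pi / K with r = 1 / (1 + log K): r log K is bounded, so the
    decay rate loses O(1 / (K^2 log K)) relative to pi^2 / K^2, while the profile
    stays above a multiple of r. *)
Definition tilted_angle : R := pi * L / ((1 + L) * K%:R).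

Lemma tilted_angle_bounds : 0 <= tilted_angle <= pi / K%:R.
Proof.
have L2 := lnK_ge_half; have K0 : 0 < K%:R :> R by rewrite ltr0n; lia.
have L0 : 0 <= L by lra.
have p0 := @pi_ge0 R.
rewrite /tilted_angle; apply/andP; split.
  by apply: divr_ge0; apply: mulr_ge0; lra.
rewrite invfM mulrA; apply: ler_wpM2r; first by rewrite invr_ge0 ltW.
by rewrite ler_pdivrMr; [apply: ler_wpM2l|]; lra.
Qed.

Lemma inv_decay_rate_le : 0 < decay_rate tilted_angle /\
  (decay_rate tilted_angle)^-1 <=
    K%:R ^+ 2 / pi ^+ 2 * ((1 + L^-1) ^+ 2 * (1 + (pi / K%:R) ^+ 2 / 8)).
Proof.
have L2 := lnK_ge_half; have K0 : 0 < K%:R :> R by rewrite ltr0n; lia.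
have K2 : 2 <= K%:R :> R by rewrite ler_nat.
have p0 := @pi_gt0 R; have p4 := @pi_lt4 R.
have /andP[t0 tpK] := tilted_angle_bounds.
have pK2 : pi / K%:R <= 2 :> R by rewrite ler_pdivrMr//; lra.
have tE : tilted_angle ^+ 2 * (K%:R ^+ 2 / pi ^+ 2 * (1 + L^-1) ^+ 2) = 1.
  have : 0 < L by lra.
  rewrite /tilted_angle; move: (pi : R) p0 L (K%:R : R) K0 => p p0 l k k0 l0.
  by field; rewrite !gt_eqF//; lra.
have tt : tilted_angle ^+ 2 <= (pi / K%:R) ^+ 2 by rewrite lerXn2r// ?nnegrE// (le_trans t0).
have tpos : 0 < tilted_angle ^+ 2.
  rewrite exprn_gt0// /tilted_angle divr_gt0 ?mulr_gt0//; lra.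
have t4 : tilted_angle ^+ 2 <= 4.
  apply: (le_trans tt); rewrite [leRHS](_ : _ = 2 ^+ 2); last by lra.
  by rewrite lerXn2r// ?nnegrE// divr_ge0// ltW.
have rge : tilted_angle ^+ 2 * (1 - tilted_angle ^+ 2 / 12) <= decay_rate tilted_angle.
  by apply: decay_rate_ge; rewrite t0 (le_trans tpK).
have rpos : 0 < decay_rate tilted_angle.
  by apply: lt_le_trans rge; rewrite mulr_gt0//; lra.
split=> //.
rewrite -[leLHS]mul1r ler_pdivrMr//.
set G := K%:R ^+ 2 / pi ^+ 2 * _.
have G0 : 0 <= G.
  apply: mulr_ge0; first by apply: divr_ge0; exact: sqr_ge0.
  by rewrite mulr_ge0 ?sqr_ge0// addr_ge0// divr_ge0 ?sqr_ge0.
apply: le_trans (ler_wpM2l G0 rge).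
set a := tilted_angle ^+ 2 in tE tt tpos t4 *; set b := (pi / K%:R) ^+ 2 in tt G G0 *.
rewrite [leRHS](_ : _ = a * (K%:R ^+ 2 / pi ^+ 2 * (1 + L^-1) ^+ 2) *
  ((1 + b / 8) * (1 - a / 12))); last by rewrite /G; ring.
rewrite tE mul1r; nra.
Qed.

(** This is where the constant 1 / pi^2 of the cutoff time is kept exactly: the
    relative error of the rate is O(1 / log K + 1 / K^2). *)
Lemma lnK_div_decay_rate_le :
  L / decay_rate tilted_angle <= K%:R ^+ 2 / pi ^+ 2 * (L + 7).
Proof.
have L2 := lnK_ge_half; have K0 : 0 < K%:R :> R by rewrite ltr0n; lia.
have K2 : 2 <= K%:R :> R by rewrite ler_nat.
have p0 := @pi_gt0 R; have p4 := @pi_lt4 R; have LK := lnK_le.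
have [rpos rle] := inv_decay_rate_le.
have L0 : 0 <= L by lra.
apply: (le_trans (ler_wpM2l L0 rle)); rewrite mulrCA ler_wpM2l//.
  by rewrite divr_ge0 ?sqr_ge0.
set b := (pi / K%:R) ^+ 2; have b2 : b <= 16 / K%:R ^+ 2.
  rewrite /b expr_div_n ler_wpM2r ?invr_ge0 ?sqr_ge0//.
  rewrite [leRHS](_ : _ = 4 ^+ 2); last by lra.
  by rewrite lerXn2r ?nnegrE//; lra.
have b0 : 0 <= b by exact: sqr_ge0.
have iK : K%:R^-1 <= 2^-1 :> R by rewrite lef_pV2 ?posrE.
have iK0 : 0 <= K%:R^-1 :> R by rewrite invr_ge0 ltW.
have b4 : b <= 4.
  by apply: (le_trans b2); rewrite -exprVn; nra.
have Lb : L * b <= 8.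
  apply: (@le_trans _ _ (K%:R * (16 / K%:R ^+ 2))); first exact: ler_pM.
  rewrite [leLHS](_ : _ = 16 * K%:R^-1); last by field; rewrite gt_eqF.
  by lra.
have iL : L^-1 <= 2.
  by rewrite -[2]invrK lef_pV2 ?posrE//; lra.
rewrite [leLHS](_ : _ = (L + 2 + L^-1) * (1 + b / 8)); last first.
  by field; rewrite gt_eqF//; lra.
apply: (@le_trans _ _ ((L + 4) * (1 + b / 8))).
  by rewrite ler_wpM2r ?addr_ge0 ?divr_ge0//; lra.
by nra.
Qed.

Lemma inv_decay_rate_le4 : (decay_rate tilted_angle)^-1 <= 4 * K%:R ^+ 2.
Proof.
have L2 := lnK_ge_half; have K0 : 0 < K%:R :> R by rewrite ltr0n; lia.
have K2 : 2 <= K%:R :> R by rewrite ler_nat.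
have p0 := @pi_gt0 R; have p4 := @pi_lt4 R; have p2 := @pi_ge2 R.
have [rpos rle] := inv_decay_rate_le.
apply: (le_trans rle).
have iL : L^-1 <= 2 by rewrite -[2]invrK lef_pV2 ?posrE//; lra.
have iL0 : 0 <= L^-1 by rewrite invr_ge0; lra.
have pK2 : pi / K%:R <= 2 :> R by rewrite ler_pdivrMr//; lra.
have pK0 : 0 <= pi / K%:R :> R by rewrite divr_ge0// ltW.
have ip : (pi ^+ 2)^-1 <= 4^-1 :> R.
  by rewrite lef_pV2 ?posrE ?exprn_gt0//; nra.
have ip0 : 0 <= (pi ^+ 2)^-1 :> R by rewrite invr_ge0 sqr_ge0.
rewrite -mulrA mulrC ler_wpM2r ?sqr_ge0//.
apply: (@le_trans _ _ (4^-1 * (9 * (3 / 2)))); last by lra.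
apply: ler_pM => //.
  by rewrite mulr_ge0 ?sqr_ge0// addr_ge0// divr_ge0 ?sqr_ge0.
apply: ler_pM; rewrite ?sqr_ge0//; first by rewrite addr_ge0// divr_ge0 ?sqr_ge0.
  by nra.
by nra.
Qed.

End RateEstimates.

(** * An explicit time after which survival is unlikely *)

Section Amplitude.
Context {R : realType}.

Lemma ln_le_predr (x : R) : 0 < x -> ln x <= x - 1.
Proof.
by move=> x0; rewrite -[x in ln x](addrNK 1) [_ + 1]addrC; apply: le_ln1Dx; lra.
Qed.

Lemma expR1_ge2 : 2 <= expR 1 :> R.
Proof. by have := @expR_ge1Dx R 1; lra. Qed.

Variable K : nat.
Hypothesis K1 : (1 < K)%N.

Local Notation L := (ln K%:R : R).

(** The factor by which the profile is multiplied so that each live particle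
    contributes at least e to the product. *)
Definition amplitude : R := 3 * expR 1 * (1 + L).

Lemma amplitude_ge1 : 1 <= amplitude.
Proof.
have L2 := @lnK_ge_half R K K1; have e2 := expR1_ge2.
by apply: mulr_ege1; lra.
Qed.

Lemma amplitude_big :
  expR 1 <= 1 + amplitude * cos (tilted_angle K * K%:R / 2).
Proof.
have L2 := @lnK_ge_half R K K1; have K0 : 0 < K%:R :> R by rewrite ltr0n; lia.
have -> : tilted_angle K * K%:R / 2 = - (pi / 2 / (1 + L) - pi / 2).
  rewrite /tilted_angle; move: L L2 => l l2; move: (pi : R) (K%:R : R) K0 => p k k0.
  by field; rewrite !gt_eqF//; lra.
rewrite cosN cosBpihalf; have p1 := @pihalf_ge1 R.
have iL0 : 0 < (1 + L)^-1 by rewrite invr_gt0; lra.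
have iL1 : (1 + L)^-1 <= 1 by rewrite invf_le1; lra.
have y0 : 0 <= pi / 2 / (1 + L) <= pi / 2.
  apply/andP; split; first by rewrite mulr_ge0 ?ltW//; lra.
  by rewrite ler_piMr//; lra.
have sin_ge : (1 + L)^-1 / 3 <= sin (pi / 2 / (1 + L)).
  apply: le_trans (sin_ge_third y0); rewrite ler_wpM2r//.
  by rewrite ler_peMl// ltW.
have a0 : 0 <= amplitude by have := amplitude_ge1; lra.
have := ler_wpM2l a0 sin_ge.
rewrite [X in X <= _ -> _](_ : _ = expR 1); first by lra.
by rewrite /amplitude; field; rewrite gt_eqF//; lra.
Qed.

End Amplitude.

Section LogarithmicCorrection.
Context {R : realType}.
Variables (K : nat) (eps : R).
Hypothesis K1 : (1 < K)%N.
Hypothesis eps01 : 0 < eps < 1.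

Local Notation L := (ln K%:R : R).
Local Notation m := (Num.min eps (1 - eps)).

(** The size of the cutoff window in units of K^2. *)
Definition log_correction : R := 1 + ln (L / m).

Local Notation Y := log_correction.

Lemma min_eps_bounds : 0 < m <= 2^-1.
Proof.
have /andP[e0 e1] := eps01.
rewrite lt_min e0 subr_gt0 e1/= ge_min.
by have [|] := leP eps 2^-1 => //= ?; lra.
Qed.

Lemma log_correctionE : Y = 1 + ln L - ln m.
Proof.
have L2 := @lnK_ge_half R K K1; have /andP[m0 _] := min_eps_bounds.
by rewrite /log_correction ln_div ?posrE//; lra.
Qed.

Lemma ln_lnK_le : ln L <= Y - 1.
Proof.
have /andP[m0 m1] := min_eps_bounds.
have : ln m <= 0 by apply: ln_le0; lra.
by rewrite log_correctionE; lra.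
Qed.

Lemma ln_min_eps_ge : - ln m <= Y.
Proof.
have L2 := @lnK_ge_half R K K1.
have l2 : ln 2 <= 1 :> R by apply: (@le_ln1Dx R 1); lra.
have : ln (2^-1) <= ln L by rewrite ler_ln ?posrE//; lra.
by rewrite lnV ?posrE// log_correctionE; lra.
Qed.

Lemma log_correction_ge1 : 1 <= Y.
Proof.
have L2 := @lnK_ge_half R K K1; have /andP[m0 m1] := min_eps_bounds.
rewrite lerDl ln_ge0// ler_pdivlMr// mul1r; lra.
Qed.

(** If the exponential moment of the number of particles, summed over the surviving
    traps, is at most e K, this number is exceeded before the traps are gone with
    probability at most eps / 2. *)
Definition threshold : R := 1 + ln (4 * K%:R / eps).

Lemma ln_amplitude_le : ln (amplitude K) <= 9 * Y.
Proof.
have L2 := @lnK_ge_half R K K1; have Y1 := log_correction_ge1.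
have e2 := @expR1_ge2 R; have lnL := ln_lnK_le.
have L0 : 0 < L by lra.
have e0 := expR_gt0 (1 : R).
have eL0 : 0 < expR 1 * L by exact: mulr_gt0.
have : ln (amplitude K) <= ln (9 * (expR 1 * L)).
  rewrite ler_ln ?posrE ?mulr_gt0//; last by have := amplitude_ge1 K1 (R := R); lra.
  rewrite /amplitude [leRHS](_ : _ = 3 * expR 1 * (3 * L)); last by ring.
  by apply: ler_wpM2l; lra.
rewrite lnM ?posrE// lnM ?posrE// expRK.
by have := @ln_le_predr R 9; lra.
Qed.

Lemma ln_eps_ge : - ln eps <= Y.
Proof.
have /andP[m0 _] := min_eps_bounds; have /andP[e0 _] := eps01.
have : ln m <= ln eps by rewrite ler_ln ?posrE// ge_min lexx.
by have := ln_min_eps_ge; lra.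
Qed.

Lemma threshold_ge1 : 1 <= threshold.
Proof.
have /andP[e0 e1] := eps01; have K2 : 2 <= K%:R :> R by rewrite ler_nat.
by rewrite lerDl ln_ge0// ler_pdivlMr//; lra.
Qed.

Lemma ln_threshold_le : ln threshold <= 9 * Y.
Proof.
have L2 := @lnK_ge_half R K K1; have Y1 := log_correction_ge1.
have K0 : 0 < K%:R :> R by rewrite ltr0n; lia.
have lnL := ln_lnK_le; have le := ln_eps_ge; have /andP[e0 e1] := eps01.
have L0 : 0 < 9 * L by lra.
have iL0 : 0 <= Y / (9 * L) by apply: divr_ge0; lra.
have iL : Y / (9 * L) <= Y by rewrite ler_piMr// ?invf_le1; lra.
have M9 : threshold <= 9 * L * (1 + Y / (9 * L)).
  rewrite [leRHS](_ : _ = 9 * L + Y); last first.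
    by rewrite mulrDr mulr1 mulrCA divff ?mulr1// gt_eqF.
  rewrite /threshold ln_div ?posrE ?mulr_gt0// lnM ?posrE//.
  by have := @ln_le_predr R 4; lra.
have : ln threshold <= ln (9 * L * (1 + Y / (9 * L))).
  by rewrite ler_ln ?posrE ?mulr_gt0//; have := threshold_ge1; lra.
have : ln (1 + Y / (9 * L)) <= Y / (9 * L) by apply: le_ln1Dx; lra.
rewrite [ln (9 * L * _)]lnM ?posrE//; last by lra.
rewrite [ln (9 * L)]lnM ?posrE//; last by lra.
by have := @ln_le_predr R 9; lra.
Qed.

End LogarithmicCorrection.

Section TransienceTime.
Context {R : realType}.
Variables (K : nat) (eps : R).
Hypothesis K1 : (1 < K)%N.
Hypothesis eps01 : 0 < eps < 1.
Variable X : swt R K.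

Local Notation L := (ln K%:R : R).
Local Notation m := (Num.min eps (1 - eps)).
Local Notation Y := (log_correction K eps).

Lemma transience_time_upper : exists T : R, [/\ 0 <= T,
  T <= tstar R K + 166 * K%:R ^+ 2 * Y &
  forall xi, occupation X (@transient K) T xi <= eps].
Proof.
have /andP[e0 e1] := eps01.
have L2 := @lnK_ge_half R K K1; have K0 : 0 < K%:R :> R by rewrite ltr0n; lia.
have Y1 := log_correction_ge1 K1 eps01.
have [rpos _] := inv_decay_rate_le K1 (R := R).
set mu := decay_rate (tilted_angle K : R) in rpos.
have ex0 := expR_gt0 (1 : R).
have big := amplitude_big K1 (R := R); have lc := ln_amplitude_le K1 eps01.
have c1 := amplitude_ge1 K1 (R := R); have M1 := threshold_ge1 K1 eps01.
have lM := ln_threshold_le K1 eps01.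
have eM : expR (- threshold K eps) = (expR 1)^-1 * (eps / (4 * K%:R)).
  rewrite /threshold opprD expRD !expRN lnK ?posrE ?divr_gt0 ?mulr_gt0//.
  by rewrite invf_div.
move: (amplitude K) (threshold K eps) big lc c1 M1 lM eM => c M big lc c1 M1 lM eM.
have c0 : 0 < c by lra.
have M0 : 0 < M by lra.
have M20 : 0 < M ^+ 2 by exact: exprn_gt0.
have cK0 : 0 < c * K%:R by exact: mulr_gt0.
have cK1 : 1 <= c * K%:R by apply: mulr_ege1 => //; rewrite ler1n; exact: ltnW.
(* These two times make each term of the two-stage bound equal to eps / 2. *)
pose D := 2 * expR 1 * c * M ^+ 2 / eps.
have pe : 0 < 2 * expR 1 :> R by exact: mulr_gt0.
have pc : 0 < 2 * expR 1 * c by exact: mulr_gt0.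
have pM : 0 < 2 * expR 1 * c * M ^+ 2 by exact: mulr_gt0.
have D0 : 0 < D by exact: divr_gt0.
have D1 : 1 <= D.
  rewrite ler_pdivlMr// mul1r; apply: le_trans (ltW e1) _.
  apply: mulr_ege1; last exact: exprn_ege1.
  by apply: mulr_ege1 => //; have := @expR1_ge2 R; lra.
pose s := ln (c * K%:R) / mu; pose t := ln D / mu.
have s0 : 0 <= s by rewrite divr_ge0 ?ln_ge0// ltW.
have t0 : 0 <= t by rewrite divr_ge0 ?ln_ge0// ltW.
have es : expR (- (mu * s)) = (c * K%:R)^-1.
  by rewrite /s mulrC divfK ?gt_eqF// expRN lnK ?posrE.
have et : expR (- (mu * t)) = D^-1.
  by rewrite /t mulrC divfK ?gt_eqF// expRN lnK ?posrE.
exists (t + s); split; first exact: addr_ge0.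
- have lD : ln D = ln 2 + 1 + ln c + ln M *+ 2 - ln eps.
    rewrite /D ln_div ?posrE// lnM ?posrE// lnM ?posrE// lnM ?posrE//.
    by rewrite expRK lnXn.
  have lnW : ln D + ln (c * K%:R) <= L + 39 * Y.
    rewrite lnM ?posrE// lD mulr2n.
    by have := ln_eps_ge K1 eps01; have := @ln_le_predr R 2; lra.
  have h1 := lnK_div_decay_rate_le K1 (R := R).
  have h2 := inv_decay_rate_le4 K1 (R := R).
  rewrite -/mu in h1 h2.
  rewrite /t /s -mulrDl.
  apply: (@le_trans _ _ ((L + 39 * Y) / mu)).
    by rewrite ler_wpM2r// invr_ge0 ltW.
  rewrite mulrDl; apply: le_trans (lerD h1 (ler_wpM2l _ h2)) _; first by lra.
  have K20 : 0 <= K%:R ^+ 2 :> R by exact: sqr_ge0.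
  have h4 : K%:R ^+ 2 / pi ^+ 2 * 7 <= K%:R ^+ 2 * (2 * Y).
    rewrite -mulrA [_^-1 * 7]mulrC; apply: ler_wpM2l => //.
    apply: (@le_trans _ _ 2); last by lra.
    rewrite ler_pdivrMr ?exprn_gt0 ?pi_gt0//.
    have : 2 * 2 <= pi ^+ 2 :> R by rewrite expr2 ler_pM// pi_ge2.
    by lra.
  have h5 : 0 <= K%:R ^+ 2 * Y by rewrite mulr_ge0//; lra.
  rewrite /tstar; move: h4 h5; set A := K%:R ^+ 2 / pi ^+ 2.
  rewrite [K%:R ^+ 2 * L / _](_ : _ = A * L); last by rewrite /A mulrAC.
  by lra.
move=> xi.
have := two_stage K1 X (tilted_angle_bounds K1) (ltW c0) big xi M1 s0 t0.
rewrite -/mu es et eM => /le_trans; apply.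
rewrite (_ : c * (c * K%:R)^-1 * K%:R = 1); last by field; rewrite !gt_eqF.
rewrite /D; move: (expR 1) ex0 => e ee0.
rewrite [leLHS](_ : _ = eps)//; field.
by rewrite !gt_eqF.
Qed.

End TransienceTime.

(** * The cutoff window *)

Section CutoffWindow.
Context {R : realType}.
Variables (K : nat) (eps : R).
Hypothesis K1 : (1 < K)%N.
Hypothesis eps01 : 0 < eps < 1.
Variable X : swt R K.

Local Notation L := (ln K%:R : R).
Local Notation m := (Num.min eps (1 - eps)).
Local Notation Y := (log_correction K eps).

Lemma sum_sine_ge (x : 'I_K) :
  K%:R / 6 <= \sum_k profile (pi / K%:R : R) x k.
Proof.
have K0 : 0 < K%:R :> R by rewrite ltr0n ltnW.
have K2 : 2 <= K%:R :> R by rewrite ler_nat.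
have p0 := @pi_gt0 R; have p4 := @pi_lt4 R.
set S := \sum_k _; set y := pi / K%:R : R.
have y0 : 0 < y by exact: divr_gt0.
have ypi : y <= pi / 2 by rewrite ler_wpM2l ?lef_pV2 ?posrE// ltW.
have yK : y * K%:R = pi by rewrite divfK// gt_eqF.
have := sum_profile K1 y x; rewrite -/S.
have -> : bump (K := K) y 0 = 0.
  by rewrite /bump sub0r mulrN cosN mulrA yK cos_pihalf.
have -> : bump (K := K) y 1 = sin y.
  by rewrite /bump mulrBr mulr1 mulrA yK cosBpihalf.
rewrite mulr0 subr0 => SE.
have siny : y / 3 <= sin y by apply: sin_ge_third; rewrite ypi andbT ltW.
have rate_le := decay_rate_le (ltW y0).
have S0 : 0 <= S.
  apply: sumr_ge0 => k _; apply: (le_trans _ (profile_ge K1 x k _)).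
    by rewrite yK cos_pihalf.
  by rewrite ltW/=.
have h : 2 * (y / 3) <= y ^+ 2 * S.
  by apply: (@le_trans _ _ (decay_rate y * S)); [rewrite SE; lra|exact: ler_wpM2r].
rewrite -(ler_pM2l (exprn_gt0 2 y0)); apply: le_trans h.
have -> : y ^+ 2 * (K%:R / 6) = y * pi / 6 by rewrite -yK; field.
by rewrite -mulrA [leRHS]mulrCA; apply: ler_wpM2l; [exact: ltW|lra].
Qed.

Lemma transience_time_lower (T : R) : 0 <= T ->
  (forall xi, occupation X (@transient K) T xi <= eps) ->
  tstar R K - 166 * K%:R ^+ 2 * Y <= T.
Proof.
move=> T0 small.
have /andP[e0 e1] := eps01; have /andP[m0 m1] := min_eps_bounds eps01.
have K0 : 0 < K%:R :> R by rewrite ltr0n ltnW.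
have Y1 := log_correction_ge1 K1 eps01; have lnm := ln_min_eps_ge K1 eps01.
have x : 'I_K by exact: Ordinal (ltnW K1).
have := le_trans (occupation_transient_ge K1 X x T0) (small _).
have Sge := sum_sine_ge x; set S := \sum_k _ in Sge *.
have p0 := @pi_gt0 R; have p2 := @pi_ge2 R.
set y := pi / K%:R : R; have y0 : 0 < y by exact: divr_gt0.
set l := decay_rate y; have l_le : l <= y ^+ 2 by exact: decay_rate_le (ltW y0).
set z := expR (- (l * T)) => bound.
have z0 : 0 < z by exact: expR_gt0.
have zS : z * S <= m^-1.
  have h : 1 - eps <= expR (- (z * S)) by lra.
  have h2 : z * S <= - ln (1 - eps).
    by rewrite lerNr -ler_expR lnK ?posrE//; lra.
  apply: (le_trans h2).
  have im : (1 - eps)^-1 <= m^-1.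
    by rewrite lef_pV2 ?posrE ?ge_min ?lexx ?orbT//; lra.
  apply: le_trans im; rewrite -lnV ?posrE; last by lra.
  by apply: le_trans (ln_le_predr _) _; [rewrite invr_gt0|]; lra.
have zK : z * (K%:R / 6) <= m^-1.
  by apply: (le_trans _ zS); apply: ler_wpM2l => //; exact: ltW.
have lnz : - (l * T) + (L - ln 6) <= - ln m.
  have : ln (z * (K%:R / 6)) <= ln (m^-1).
    by rewrite ler_ln ?posrE ?mulr_gt0 ?invr_gt0.
  by rewrite lnM ?posrE ?divr_gt0// ln_div ?posrE// lnV ?posrE// expRK.
have l6 := @ln_le_predr R 6.
have h1 : L - 6 * Y <= y ^+ 2 * T.
  by apply: (@le_trans _ _ (l * T)); [lra|exact: ler_wpM2r].
have y2 : y ^+ 2 * (K%:R ^+ 2 / pi ^+ 2) = 1.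
  rewrite /y; move: (pi : R) p0 (K%:R : R) K0 => p pp k kp.
  by field; rewrite !gt_eqF.
have A0 : 0 <= K%:R ^+ 2 / pi ^+ 2 :> R by apply: divr_ge0; exact: sqr_ge0.
have := ler_wpM2r A0 h1.
rewrite [leRHS]mulrAC y2 mul1r; apply: le_trans.
rewrite /tstar; set A := K%:R ^+ 2 / pi ^+ 2 in A0 *.
rewrite [K%:R ^+ 2 * L / _](_ : _ = A * L); last by rewrite /A mulrAC.
have AK : A <= K%:R ^+ 2.
  rewrite /A ler_pdivrMr ?exprn_gt0// ler_peMr ?sqr_ge0//.
  by rewrite exprn_ege1//; lra.
have := ler_wpM2r (le_trans ler01 Y1) AK.
have : 0 <= A * Y by rewrite mulr_ge0//; lra.
by lra.
Qed.

Lemma transient_probE (T : R) : 0 <= T ->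
  (transient_prob X T <= eps%:E)%E <->
  (forall xi, occupation X (@transient K) T xi <= eps).
Proof.
move=> T0.
have E xi : transient_prob_from X xi T = (occupation X (@transient K) T xi)%:E.
  by rewrite /occupation fineK//; exact/prob_fin_num/mp_measurable.
split=> [le xi|le].
  rewrite -lee_fin -E; apply: le_trans le.
  by apply: ereal_sup_ubound; exists xi.
by apply: ge_ereal_sup => _ [xi _ <-]; rewrite E lee_fin.
Qed.

Lemma transience_time_window : exists2 T : R,
  transience_time X eps = T%:E & `|T - tstar R K| <= 166 * K%:R ^+ 2 * Y.
Proof.
set W := 166 * K%:R ^+ 2 * Y.
have lower : ((tstar R K - W)%:E <= transience_time X eps)%E.
  apply: le_ereal_inf_tmp => _ [T [T0 small] <-]; rewrite lee_fin.
  by apply: transience_time_lower => //; apply/transient_probE.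
have upper : (transience_time X eps <= (tstar R K + W)%:E)%E.
  have [T [T0 Tle small]] := transience_time_upper K1 eps01 X.
  apply: (@le_trans _ _ T%:E); last by rewrite lee_fin.
  by apply: ereal_inf_lbound; exists T => //; split=> //; apply/transient_probE.
have fin : transience_time X eps \is a fin_num.
  by rewrite fin_numE; apply/andP; split; apply/eqP => E;
    rewrite E in lower upper.
exists (fine (transience_time X eps)); first by rewrite fineK.
rewrite ler_distl; move: lower upper; rewrite -(fineK fin) !lee_fin.
by move=> -> ->.
Qed.

End CutoffWindow.

(** Since ln x < x, log log K is at most (d / 2) log K + ln (2 / d). *)
Lemma log_correction_negligible (R : realType) (eps d : R) :
  0 < eps < 1 -> 0 < d ->
  \forall K \near \oo, log_correction K eps <= d * ln K%:R.
Proof.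
move=> eps01 d0; have /andP[m0 m1] := min_eps_bounds eps01.
set m := Num.min eps (1 - eps) in m0 m1.
pose B := (1 + ln (2 / d) - ln m) * (2 / d).
near=> K.
have K1 : (1 < K)%N by near: K; exact: nbhs_infty_ge.
have L2 := @lnK_ge_half R K K1.
have K0 : 0 < K%:R :> R by rewrite ltr0n ltnW.
have LB : B <= ln K%:R.
  rewrite -ler_expR lnK ?posrE//.
  by near: K; exact: nbhs_infty_ger.
have L0 : 0 < ln K%:R :> R by lra.
have A0 : 0 < 2 / d by exact: divr_gt0.
rewrite log_correctionE// -/m.
have lnL : ln (ln K%:R) <= ln K%:R / (2 / d) + ln (2 / d).
  rewrite -[X in ln X](divfK (lt0r_neq0 A0)) lnM ?posrE ?divr_gt0// lerD2r.
  by rewrite ltW// ln_sublinear// divr_gt0.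
have : (1 + ln (2 / d) - ln m) <= ln K%:R / (2 / d) by rewrite ler_pdivlMr.
rewrite [ln K%:R / _](_ : _ = d / 2 * ln K%:R) in lnL *; last first.
  by field; rewrite gt_eqF.
by lra.
Unshelve. all: by end_near.
Qed.

Lemma transience_time_ratio (R : realType) (X : forall K : nat, swt R K) (eps : R) :
  0 < eps < 1 ->
  fine (transience_time (X K) eps) / tstar R K @[K --> \oo] --> (1 : R).
Proof.
move=> eps01; apply/cvgrPdist_le => d d0.
have p0 := @pi_gt0 R.
have d'0 : 0 < d / (166 * pi ^+ 2) by rewrite divr_gt0// mulr_gt0// exprn_gt0.
near=> K.
have K1 : (1 < K)%N by near: K; exact: nbhs_infty_ge.
have Yd : log_correction K eps <= d / (166 * pi ^+ 2) * ln K%:R.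
  by near: K; exact: log_correction_negligible.
have [T -> /= Tle] := transience_time_window K1 eps01 (X K).
have L0 : 0 < ln K%:R :> R by have := @lnK_ge_half R K K1; lra.
have K0 : 0 < K%:R :> R by rewrite ltr0n ltnW.
have ts0 : 0 < tstar R K by rewrite divr_gt0 ?mulr_gt0 ?exprn_gt0.
rewrite distrC -[X in T / _ - X](divff (lt0r_neq0 ts0)) -mulrBl normrM.
rewrite normfV (gtr0_norm ts0) ler_pdivrMr//; apply: (le_trans Tle).
have := ler_wpM2l _ Yd => /(_ (166 * K%:R ^+ 2)) /(_ _)/le_trans; apply.
  by rewrite mulr_ge0 ?sqr_ge0.
rewrite /tstar le_eqVlt; apply/orP; left; apply/eqP.
by move: (pi : R) p0 => p pp; field; rewrite gt_eqF.
Unshelve. all: by end_near.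
Qed.

Theorem theorem1p2 (R : realType) (X : forall K : nat, swt R K) :
  (exists C : R, 0 < C /\
    forall (K : nat) (eps : R), (2 <= K)%N -> 0 < eps < 1 ->
      (`|transience_time (X K) eps - (tstar R K)%:E| <=
        (C * K%:R ^+ 2 *
          (1 + ln (ln K%:R / Num.min eps (1 - eps))))%:E)%E) /\
  (forall eps : R, 0 < eps < 1 ->
    (fine (transience_time (X K) eps) / fine (transience_time (X K) (1 / 4)))
      @[K --> \oo] --> (1 : R)).
Proof.
split.
  exists 166; split=> // K eps K2 eps01.
  have [T -> Tle] := transience_time_window K2 eps01 (X K).
  by rewrite -EFinB abse_EFin lee_fin.
move=> eps eps01; have quarter01 : 0 < (1 / 4 : R) < 1 by lra.
have H : (fine (transience_time (X K) eps) / tstar R K) /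
    (fine (transience_time (X K) (1 / 4)) / tstar R K) @[K --> \oo] --> (1 / 1 : R).
  apply: cvgM; first exact: transience_time_ratio.
  by apply: cvgV; [exact: oner_neq0|exact: transience_time_ratio].
rewrite divr1 in H; apply: cvg_trans H; apply: near_eq_cvg; near=> K.
have K1 : (1 < K)%N by near: K; exact: nbhs_infty_ge.
have L0 : 0 < ln K%:R :> R by have := @lnK_ge_half R K K1; lra.
have K0 : 0 < K%:R :> R by rewrite ltr0n ltnW.
have ts0 : 0 < tstar R K by rewrite divr_gt0 ?mulr_gt0 ?exprn_gt0 ?pi_gt0.
have cancel (a b : R) : a / tstar R K / (b / tstar R K) = a / b.
  by move: (tstar R K) ts0 => t t0; rewrite invf_div mulrA divfK// lt0r_neq0.
by rewrite /= cancel.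
Unshelve. all: by end_near.
Qed.
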